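(* Let $n$ and $t$ be integers with $n\geq t\geq 200$, let $p$ be a real number with $\frac{1}{t+1}\leq p\leq \frac{2}{t+3}$, and set $q=1-p$. If $\mathcal{A}\subset 2^{[n]}$ and $\mathcal{B}\subset 2^{[n]}$ are cross $t$-intersecting, then \[ \mu_p(\mathcal{A})\,\mu_p(\mathcal{B})\leq \big(\mu_p(\mathcal{F}^t_1)\big)^2=\Big( (t+2)p^{t+1}q + p^{t+2} \Big)^2. \] Moreover, equality holds if and only if one of the following holds: (1) $\mathcal{A}=\mathcal{B}\cong \mathcal{F}^t_0$ and $p=\frac{1}{t+1}$; (2) $\mathcal{A}=\mathcal{B}\cong \mathcal{F}^t_1$ and $\frac{1}{t+1}\leq p\leq \frac{2}{t+3}$; (3) $\mathcal{A}=\mathcal{B}\cong \mathcal{F}^t_2$ and $p=\frac{2}{t+3}$.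
   Context: $[n]=\{1,\dots,n\}$. For $0<p<1$, $q=1-p$, and a family $\mathcal{F}\subset 2^{[n]}$, the $p$-weight is $\mu_p(\mathcal{F})=\sum_{F\in\mathcal{F}}p^{|F|}q^{n-|F|}$. Two families $\mathcal{A},\mathcal{B}\subset 2^{[n]}$ are cross $t$-intersecting if $|A\cap B|\geq t$ for every $A\in\mathcal{A}$ and $B\in\mathcal{B}$. For integers $t\ge 1$, $i\geq 0$, $\mathcal{F}^t_i=\{F\subset[n]: |F\cap[t+2i]|\geq t+i\}$. Two families $\mathcal{G}_1,\mathcal{G}_2\subset 2^{[n]}$ are isomorphic, written $\mathcal{G}_1\cong\mathcal{G}_2$, if there is a permutation $\sigma$ of $[n]$ with $\mathcal{G}_1=\{\{\sigma(k):k\in G\}: G\in\mathcal{G}_2\}$.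
   Formalization: For n<t+2 the claim fails (n=t: F^t_1 is empty but A=B={[t]} has positive weight). The bound is by the explicit formula for all n≥t; μ_p(F^t_1)^2=formula and case (2) are stated for n≥t+2, case (3) for n≥t+4 (truncated families miss the bound). *)

(* Defs.v *)
From mathcomp Require Import all_boot all_order all_algebra all_fingroup.
From mathcomp Require Import reals.

Set Implicit Arguments.
Unset Strict Implicit.
Unset Printing Implicit Defensive.

Import Order.TTheory GRing.Theory Num.Theory.
Local Open Scope ring_scope.

(* The ground set [n] = {1, ..., n} is 'I_n = {0, ..., n - 1}, so that
   [m] (intersected with [n]) becomes {k : 'I_n | k < m}. *)
Definition initseg (n m : nat) : {set 'I_n} := [set k : 'I_n | (k < m)%N].

Definition pweight (R : realType) (p : R) (n : nat) (F : {set {set 'I_n}}) : R :=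
  \sum_(A in F) p ^+ #|A| * (1 - p) ^+ (n - #|A|).

Definition cross_intersecting (t n : nat) (A B : {set {set 'I_n}}) : Prop :=
  forall X Y : {set 'I_n}, X \in A -> Y \in B -> (t <= #|X :&: Y|)%N.

(* Only meaningful when t + 2 i <= n: otherwise [t + 2 i] is cut down to [n]. *)
Definition frankl (n t i : nat) : {set {set 'I_n}} :=
  [set F : {set 'I_n} | (t + i <= #|F :&: initseg n (t + 2 * i)|)%N].

Definition isomorphic (n : nat) (G1 G2 : {set {set 'I_n}}) : Prop :=
  exists s : {perm 'I_n}, G1 = [set s @: G | G : {set 'I_n} in G2].

(* Main.v *)
Require Import Defs.
From mathcomp Require Import all_boot all_order all_algebra all_fingroup.
From mathcomp Require Import boolp reals sequences exp.
From mathcomp Require Import zify ring lra.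

Set Implicit Arguments.
Unset Strict Implicit.
Unset Printing Implicit Defensive.

Import Order.TTheory GRing.Theory Num.Theory.
Local Open Scope ring_scope.

(* Read a subset of [n] as a walk going up at its elements and down elsewhere.
   After shifting, any X in A and Y in B have heights adding up to at least 2t at
   some common time. Let u and v be the largest levels reached by all walks of A
   and of B; then u + v >= 2t, and level u is reached with probability at most
   (p/q)^u, which settles u + v > 2t. If u + v = 2t, either most walks of one
   family return to their maximum, which is too rare, or there is a time
   s = t + a + 2j at which all walks of A with maximum u are at level u = t - a, and
   all walks of B with maximum v at level v = t + a. A numerical comparison leaves
   a = 0, j <= 2 and a = 1, j <= 1. There A and B are compared with the families
   {height at s >= u} and {height at s >= v}. The part of B outside its family can
   only gain what A loses: the continuations after time s satisfy a
   cross-intersection condition, which bounds the gain by the r-th power of the loss,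
   where q^r is about p. Hence both families are exact, and their weights are compared
   explicitly. Finally shifting is undone: a pair of families shifted to
   {F : |F /\ S| >= t + r} is itself a pair of equal families of this form. *)

(** * Product measure on words *)

(** With al = p/q, the hitting bound fails exactly when u + v = 2t: al^(2t) is too large, but one
    more factor al, of order 1/t, brings it down to 1/6.9 of the target; t >= 200 makes 6.9
    available. So only pairs of walks pinned at their maximum matter. In the far cases these take at
    most 69/100 of the target, and the remaining terms at most (2 + 1/99)/6.9 < 31/100. In the near
    cases the obstacle is that the loss may be arbitrarily small, while the hitting bound on the
    gain is a fixed power of al. A bound vanishing with the loss is needed. It comes from
    complementation: the continuations allowed to B, once complemented, are disjoint from those
    present in A, so their q-measure is at most the loss; going from q to p raises it to a power.
    The hitting bound is kept for large losses. The ends 1/(t+1) and 2/(t+3) of the range of p are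
    where the weight of F^t_1 ties with those of F^t_0 and F^t_2, whence the three cases of
    equality. *)

Section BernoulliMeasure.
Variable R : realFieldType.
Implicit Types (p q : R) (P Q U : pred (seq bool)) (w : seq bool).

Fixpoint mu p n P : R :=
  if n is n'.+1 then
    p * mu p n' (fun w => P (true :: w)) + (1 - p) * mu p n' (fun w => P (false :: w))
  else (P [::])%:R.

Lemma mu_ge0 p n P : 0 <= p <= 1 -> 0 <= mu p n P.
Proof.
move=> /andP[p0 p1]; elim: n P => [|n IH] P /=; first exact: ler0n.
by rewrite addr_ge0 ?mulr_ge0 ?IH ?subr_ge0.
Qed.

Lemma mu_le p n P Q : 0 <= p <= 1 ->
  (forall w, size w = n -> P w -> Q w) -> mu p n P <= mu p n Q.
Proof.
move=> /andP[p0 p1]; elim: n P Q => [|n IH] P Q PQ /=.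
  by case: (P [::]) (PQ [::] erefl) => [->|] //; rewrite ler0n.
rewrite lerD // ler_wpM2l ?subr_ge0 // IH // => w sw; apply: PQ; exact: congr1 sw.
Qed.

Lemma eq_mu p n P Q : (forall w, size w = n -> P w = Q w) -> mu p n P = mu p n Q.
Proof.
elim: n P Q => [|n IH] P Q PQ /=; first by rewrite PQ.
by congr (_ * _ + _ * _); apply: IH => w sw; apply: PQ; rewrite /= sw.
Qed.

(** For 0 < p < 1 every word has positive mass. This turns equal weights into equal families in the
    equality case. *)
Lemma mu_inj p n P Q : 0 < p < 1 -> (forall w, size w = n -> P w -> Q w) ->
  mu p n Q <= mu p n P -> forall w, size w = n -> P w = Q w.
Proof.
move=> /andP[p0 p1]; elim: n P Q => [|n IH] P Q PQ /= le.
  case=> // _; move: le (PQ [::] erefl).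
  by case: (P [::]); case: (Q [::]) => //=; rewrite ?ler10 // => _ /(_ isT).
have q0 : 0 < 1 - p by rewrite subr_gt0.
have p01 : 0 <= p <= 1 by rewrite !ltW.
have hb b w : size w = n -> P (b :: w) -> Q (b :: w).
  by move=> sw; apply: PQ; rewrite /= sw.
have lt := mu_le p01 (hb true); have lf := mu_le p01 (hb false).
rewrite -(ler_pM2l p0) in lt; rewrite -(ler_pM2l q0) in lf.
case=> // b w [sw]; case: b.
  by apply: (IH (fun w => P (true :: w)) (fun w => Q (true :: w))) => // [w'|];
    [apply: hb | rewrite -(ler_pM2l p0); lra].
by apply: (IH (fun w => P (false :: w)) (fun w => Q (false :: w))) => // [w'|];
  [apply: hb | rewrite -(ler_pM2l q0); lra].
Qed.

Lemma mu_eq0 p n P : 0 < p < 1 -> mu p n P <= 0 ->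
  forall w, size w = n -> ~~ P w.
Proof.
move=> p01 P0 w sw; rewrite -(@mu_inj p n (fun=> false) P p01 _ _ w sw) //.
apply: le_trans P0 _; apply: mu_ge0; case/andP: p01 => *; by rewrite !ltW.
Qed.

Lemma mu_pred0 p n P : (forall w, size w = n -> ~~ P w) -> mu p n P = 0.
Proof.
elim: n P => [|n IH] P P0 /=; first by rewrite (negbTE (P0 _ _)).
by rewrite !IH ?mulr0 ?addr0 // => w sw; apply: P0; rewrite /= sw.
Qed.

Lemma mu_predT p n P : (forall w, size w = n -> P w) -> mu p n P = 1.
Proof.
elim: n P => [|n IH] P PT /=; first by rewrite PT.
by rewrite !IH ?mulr1; [ring| |] => w sw; apply: PT; rewrite /= sw.
Qed.

Lemma mu_le1 p n P : 0 <= p <= 1 -> mu p n P <= 1.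
Proof.
move=> p01; rewrite -(@mu_predT p n xpredT) //; exact: mu_le.
Qed.

Lemma mu_split p n P Q :
  mu p n P = mu p n (fun w => P w && Q w) + mu p n (fun w => P w && ~~ Q w).
Proof.
elim: n P Q => [|n IH] P Q /=.
  by case: (P _); case: (Q _); rewrite /= ?addr0 ?add0r.
rewrite (IH (fun w => P (true :: w)) (fun w => Q (true :: w))).
rewrite (IH (fun w => P (false :: w)) (fun w => Q (false :: w))); ring.
Qed.

Lemma mu_orD p n P Q : (forall w, size w = n -> ~~ (P w && Q w)) ->
  mu p n (fun w => P w || Q w) = mu p n P + mu p n Q.
Proof.
move=> dis; rewrite (mu_split _ _ _ P); congr (_ + _); apply: eq_mu => w sw.
  by case: (P w); case: (Q w).
by have := dis w sw; case: (P w); case: (Q w).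
Qed.

Lemma mu_le_split p n P Q S : 0 <= p <= 1 ->
  (forall w, size w = n -> P w -> Q w || S w) -> mu p n P <= mu p n Q + mu p n S.
Proof.
move=> p01 PQS; rewrite (mu_split _ _ P Q) lerD // mu_le // => w sw.
  by case/andP.
by case/andP=> Pw /negbTE Qw; have := PQS w sw Pw; rewrite Qw.
Qed.

Lemma mu_cat p m n P Q :
  mu p (m + n) (fun w => P (take m w) && Q (drop m w)) = mu p m P * mu p n Q.
Proof.
elim: m P => [|m IH] P /=.
  case P0: (P [::]).
    by rewrite mul1r; apply: eq_mu => w _; rewrite take0 drop0 P0.
  by rewrite mul0r mu_pred0 // => w _; rewrite take0 P0.
by rewrite (IH (fun w => P (true :: w))) (IH (fun w => P (false :: w))); ring.
Qed.

(** Lets disjointness of one family from the complements of another bound the sum of a p-measure and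
    a q-measure by 1. *)
Lemma mu_compl p n P : mu p n P = mu (1 - p) n (fun w => P (map negb w)).
Proof.
by elim: n P => [//|n IH] P /=; rewrite 2!IH subKr addrC.
Qed.

Lemma mu_count p s k :
  mu p s (fun w => (count id w + k == s)%N) = 'C(s, k)%:R * p ^+ (s - k) * (1 - p) ^+ k.
Proof.
elim: s k => [|s IH] k /=; first by case: k => [|k]; rewrite bin0n /= ?mul0r ?mulr1.
rewrite IH; case: k => [|k].
  rewrite mu_pred0 => [|w sw]; last first.
    by have := count_size id w; rewrite sw addn0 add0n -ltnS => /ltn_eqF ->.
  by rewrite !bin0 !subn0 exprS; ring.
rewrite (@eq_mu _ _ _ (fun w => (count id w + k == s)%N)) => [|w sw]; last first.
  by rewrite add0n addnS eqSS.
rewrite IH binS natrD subSS.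
have [lt|ge] := ltnP k s; last first.
  by rewrite (@bin_small s k.+1) ?ltnS //; rewrite exprS; ring.
by rewrite -(subnSK lt) !exprS; ring.
Qed.

(* If [p = q^r], the intersection of [r] independent [q]-random sets is [p]-random,
   and an up-set containing the intersection contains all of them; [key] below is the
   one-coordinate form of this. *)
Lemma mu_upset_pow p q r n U : 0 <= p -> 0 <= q <= 1 -> p <= q ^+ r ->
  (forall x y, U (x ++ false :: y) -> U (x ++ true :: y)) ->
  mu p n U <= mu q n U ^+ r.
Proof.
move=> p0 /andP[q0 q1] pq.
have p01 : 0 <= p <= 1 by rewrite p0 (le_trans pq) // exprn_ile1.
have q01 : 0 <= q <= 1 by rewrite q0.
have key y0 d : 0 <= y0 -> 0 <= d ->
    y0 ^+ r + q ^+ r * ((y0 + d) ^+ r - y0 ^+ r) <= (y0 + q * d) ^+ r.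
  move=> y00 d0; elim: (r) => [|k IHk]; first by rewrite !expr0; lra.
  have qd : 0 <= y0 + q * d by rewrite addr_ge0 ?mulr_ge0.
  have le2 := ler_wpM2l qd IHk.
  have qk1 : q ^+ k <= 1 by rewrite exprn_ile1.
  have qk0 : 0 <= q ^+ k by rewrite exprn_ge0.
  have yk0 : 0 <= y0 ^+ k by rewrite exprn_ge0.
  have yk : y0 ^+ k <= (y0 + d) ^+ k by rewrite lerXn2r ?nnegrE ?addr_ge0 // lerDl.
  rewrite -exprS in le2; apply: le_trans le2; rewrite !exprS -subr_ge0.
  set Y := (y0 + d) ^+ k in yk *; set y := y0 ^+ k in yk0 yk *; set Q := q ^+ k in qk1 qk0 *.
  have -> : (y0 + q * d) * (y + Q * (Y - y)) -
     (y0 * y + q * Q * ((y0 + d) * Y - y0 * y))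
     = (q * d * y) * (1 - Q) + (Q * (Y - y)) * (y0 * (1 - q)) by ring.
  by rewrite addr_ge0 ?mulr_ge0 ?subr_ge0.
elim: n U => [|n IH] U up /=.
  by case: (U [::]) => /=; rewrite ?expr1n // exprn_ge0.
have h1 : mu p n (fun w => U (true :: w)) <= mu q n (fun w => U (true :: w)) ^+ r.
  by apply: IH => x y; apply: (up (true :: x)).
have h0 : mu p n (fun w => U (false :: w)) <= mu q n (fun w => U (false :: w)) ^+ r.
  by apply: IH => x y; apply: (up (false :: x)).
have le01 : mu q n (fun w => U (false :: w)) <= mu q n (fun w => U (true :: w)).
  by apply: mu_le => // w _; apply: (up [::]).
have y00 := mu_ge0 n (fun w => U (false :: w)) q01.
set y0 := mu q n (fun w => U (false :: w)) in y00 h0 le01 *.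
set y1 := mu q n (fun w => U (true :: w)) in h1 le01 *.
have d0 : 0 <= y1 - y0 by rewrite subr_ge0.
have := key _ _ y00 d0.
have -> : y0 + (y1 - y0) = y1 by ring.
have -> : y0 + q * (y1 - y0) = q * y1 + (1 - q) * y0 by ring.
apply: le_trans.
have yr : y0 ^+ r <= y1 ^+ r by rewrite lerXn2r ?nnegrE // (le_trans y00).
apply: (@le_trans _ _ (y0 ^+ r + p * (y1 ^+ r - y0 ^+ r))).
  have /andP[_ p1] := p01.
  have a1 := ler_wpM2l p0 h1.
  have a2 : (1 - p) * mu p n (fun w => U (false :: w)) <= (1 - p) * y0 ^+ r.
    by rewrite ler_wpM2l // subr_ge0.
  lra.
by rewrite lerD2l ler_wpM2r // subr_ge0.
Qed.

End BernoulliMeasure.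

(** * Walks *)

(* [true] is a step up and [false] a step down; [u] is the distance still to climb. *)
Fixpoint hit (u : nat) (w : seq bool) {struct w} : bool :=
  match u, w with
  | 0%N, _ => true
  | u'.+1, [::] => false
  | u'.+1, b :: w' => hit (if b then u' else u'.+2) w'
  end.

(* For walks with maximum exactly [u]: level [u] is reached, left and reached again. *)
Fixpoint hit_again (u : nat) (w : seq bool) {struct w} : bool :=
  match u, w with
  | _, [::] => false
  | 0%N, b :: w' => ~~ b && hit 1 w'
  | u'.+1, b :: w' => hit_again (if b then u' else u'.+2) w'
  end.

(** After [s] steps with c ups the height is 2c - s, so the inequality says height at least [u];
    with unit steps, a walk at or above [u] has passed through [u]. *)
Lemma hitP u w :
  reflect (exists2 s, (s <= size w)%N & (s + u <= 2 * count id (take s w))%N) (hit u w).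
Proof.
elim: w u => [|b w IH] [|u] /=; try by constructor; exists 0%N.
  by constructor => -[s] /=; lia.
apply: (iffP (IH _)) => -[s].
  by move=> sw h; exists s.+1 => //=; case: b h => /=; lia.
case: s => [|s] /= sw h; first by lia.
by exists s => //; case: b h => /=; lia.
Qed.

(** The first arrival at [u] is no later than [s1]. A step up there would reach [u.+1], so the walk
    steps down, and being back at [s2] is a climb by one. *)
Lemma hit_againP u w s1 s2 : (s1 < s2 <= size w)%N ->
  (s1 + u = 2 * count id (take s1 w))%N -> (s2 + u = 2 * count id (take s2 w))%N ->
  ~~ hit u.+1 w -> hit_again u w.
Proof.
elim: w u s1 s2 => [|b w IH] u s1 s2 /=; first by lia.
case: u => [|u] s12; case: s2 s12 => [|s2] //= s12 h1 h2.
  case: b {h1} h2 => /=; first by case: (w).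
  move=> h2 _; apply/hitP; exists s2; lia.
case: s1 s12 h1 => [|s1] /= s12 h1; first by lia.
by case: b h1 h2 => /= h1 h2 nh; apply: (IH _ s1 s2) => //; lia.
Qed.

Section Walks.
Variables (R : realType) (p : R).
Hypothesis p_gt0 : 0 < p.
Hypothesis p_lt1 : p < 1.
Let q : R := 1 - p.
Let al : R := p / q.

Let q_gt0 : 0 < q. Proof. by rewrite subr_gt0. Qed.
Let q_neq0 : q != 0. Proof. by rewrite gt_eqF. Qed.
Let al_gt0 : 0 < al. Proof. exact: divr_gt0. Qed.
Let p_ge0 : 0 <= p. Proof. exact: ltW. Qed.
Let q_ge0 : 0 <= q. Proof. exact: ltW. Qed.
Let al_ge0 : 0 <= al. Proof. exact: ltW. Qed.
Let al_rec : p + q * al * al = al. Proof. by rewrite /al /q; field. Qed.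
Let p01 : 0 <= p <= 1. Proof. by rewrite !ltW. Qed.

(** Since al = p + q al^2, [al ^+ u] is preserved by the one-step average, hence dominates the
    hitting probability for every length. *)
Lemma mu_hit n u : mu p n (hit u) <= al ^+ u.
Proof.
elim: n u => [|n IH] [|u]; rewrite ?expr0 ?mu_le1 //= ?exprn_ge0 //.
have h1 : p * mu p n (fun w => hit u w) <= p * al ^+ u by rewrite ler_wpM2l.
have h2 : (1 - p) * mu p n (fun w => hit u.+2 w) <= q * al ^+ u.+2.
  by rewrite ler_wpM2l.
apply: (le_trans (lerD h1 h2)); rewrite !exprS.
have -> : p * al ^+ u + q * (al * (al * al ^+ u)) = (p + q * al * al) * al ^+ u by ring.
by rewrite al_rec.
Qed.

(** Arriving at [u] costs [al ^+ u]; the step down and the climb by one that follow cost q al =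
    p. *)
Lemma mu_hit_again n u : mu p n (hit_again u) <= p * al ^+ u.
Proof.
elim: n u => [|n IH] [|u] /=; rewrite ?mulr_ge0 ?exprn_ge0 //.
  rewrite (@mu_pred0 _ _ _ (fun=> false)) // mulr0 add0r expr0 mulr1.
  apply: (@le_trans _ _ (q * al ^+ 1)); first by rewrite ler_wpM2l ?mu_hit.
  by rewrite expr1 /al mulrC divfK.
have h1 : p * mu p n (fun w => hit_again u w) <= p * (p * al ^+ u) by rewrite ler_wpM2l.
have h2 : (1 - p) * mu p n (fun w => hit_again u.+2 w) <= q * (p * al ^+ u.+2).
  by rewrite ler_wpM2l.
apply: (le_trans (lerD h1 h2)); rewrite !exprS.
have -> : p * (p * al ^+ u) + q * (p * (al * (al * al ^+ u))) =
          (p + q * al * al) * (p * al ^+ u) by ring.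
by rewrite al_rec mulrCA.
Qed.

Lemma exists_expn_bracket : p <= q -> exists2 r, p <= q ^+ r.+1 & q ^+ r.+2 < p.
Proof.
move=> pq; have ber m : 1 + m%:R * p <= q^-1 ^+ m.
  elim: m => [|m IH]; first by rewrite mul0r addr0.
  have q1 : 1 + p <= q^-1.
    by rewrite -[leRHS]mul1r ler_pdivlMr // /q; nra.
  rewrite exprS; apply: (@le_trans _ _ ((1 + p) * (1 + m%:R * p))).
    have : 0 <= m%:R * p * p :> R by rewrite !mulr_ge0.
    by rewrite -natr1; nra.
  by apply: ler_pM; rewrite ?addr_ge0 ?mulr_ge0 //.
have ex : exists m, q ^+ m < p.
  (* m > 1/p^2 gives 1 + m p > 1/p in [ber], hence q^m < p. *)
  have [m hm] : exists m : nat, (p * p)^-1 < m%:R.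
    by exists (Num.bound (p * p)^-1); rewrite archi_boundP // invr_ge0 mulr_ge0 //.
  exists m; rewrite -[ltLHS]invrK -exprVn invf_plt ?posrE ?exprn_gt0 ?invr_gt0 //.
  apply: lt_le_trans (ber m).
  have : (p * p)^-1 * p < m%:R * p by rewrite ltr_pM2r.
  have -> : (p * p)^-1 * p = p^-1 by field; rewrite gt_eqF.
  lra.
case: (ex_minnP ex) => -[|[|r]] hr min.
- by move: hr; rewrite expr0 => /lt_trans/(_ p_lt1); rewrite ltxx.
- by move: hr; rewrite expr1 => /lt_le_trans/(_ pq); rewrite ltxx.
by exists r => //; rewrite leNgt; apply/negP => /min; rewrite ltnn.
Qed.

(* Below the threshold [dl = q^(L+2)] use the power bound with [q^(r+1) < p <= q^r],
   above it the hitting bound. *)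
Lemma gain_le_loss (ep dl F k : R) L : p <= q -> 0 <= dl ->
  0 <= F -> 0 <= k -> ep <= al ^+ L.+1 -> (forall r, p <= q ^+ r -> ep <= dl ^+ r) ->
  p ^+ L.+1 <= k * F * q ^+ (2 * L + 3) -> ep <= k * F * dl.
Proof.
move=> pq dl0 F0 k0 epal epdl num.
have kF : 0 <= k * F by rewrite mulr_ge0.
have [ge|lt] := leP (q ^+ L.+2) dl.
  apply: (le_trans epal); rewrite /al expr_div_n ler_pdivrMr ?exprn_gt0 //.
  apply: (le_trans num).
  (* L + 1 powers of q pay for the denominator of [al ^+ L.+1], the other L + 2 are the
     threshold. *)
  have -> : (2 * L + 3 = L.+2 + L.+1)%N by clear; lia.
  by rewrite exprD mulrA ler_wpM2r ?exprn_ge0 // ler_wpM2l.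
have [r r1 r2] := exists_expn_bracket pq.
apply: (le_trans (epdl _ r1)); rewrite exprS mulrC ler_wpM2r //.
set th := q ^+ L.+2 in lt *; have th0 : 0 < th by rewrite exprn_gt0.
have le1 : dl ^+ r <= th ^+ r by rewrite lerXn2r ?nnegrE ?(ltW lt) ?(ltW th0).
(* The factor th^2 turns th^r into (q^(r+2))^(L+2) <= p^(L+2); then [num] closes this regime too, p
   <= q supplying the one missing power of q. *)
apply: (le_trans le1); rewrite -(ler_pM2r (exprn_gt0 2 th0)) -exprD.
have -> : th ^+ (r + 2) = (q ^+ r.+2) ^+ L.+2 by rewrite /th -!exprM addn2 mulnC.
apply: (@le_trans _ _ (p ^+ L.+2)); first by rewrite lerXn2r ?nnegrE ?exprn_ge0 ?(ltW r2).
rewrite exprS; apply: (@le_trans _ _ (p * (k * F * q ^+ (2 * L + 3)))).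
  by rewrite ler_wpM2l.
rewrite mulrCA ler_wpM2l // /th -exprM.
have -> : (L.+2 * 2 = (2 * L + 3).+1)%N by clear; lia.
by rewrite exprS ler_wpM2r ?exprn_ge0 //.
Qed.
End Walks.

(** * Families close to a threshold family *)

(* At most [i] of the first [s] steps are down, that is, the height at time [s] is at
   least [s - 2 i]. *)
Definition tall s i (w : seq bool) := (s <= count id (take s w) + i)%N.

(** Half of the condition that the heights at time [k], each of the form 2c - k, add up to at least
    2t. *)
Definition walk_cross t n (A B : pred (seq bool)) :=
  forall X Y, size X = n -> size Y = n -> A X -> B Y ->
  exists2 k, (k <= n)%N & (k + t <= count id (take k X) + count id (take k Y))%N.

Lemma count_take_mono k l (w : seq bool) : (k <= l)%N ->
  (count id (take k w) <= count id (take l w) <= count id (take k w) + (l - k))%N.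
Proof.
move=> kl; rewrite -(subnKC kl) addKn takeD count_cat leq_addr leq_add2l.
by apply: leq_trans (count_size _ _) _; rewrite size_take_min geq_minl.
Qed.

Lemma count_take_le k (w : seq bool) : (count id (take k w) <= k)%N.
Proof. by apply: leq_trans (count_size _ _) _; rewrite size_take_min geq_minl. Qed.

Section NearExtremal.
Variables (R : realType) (p : R).
Hypothesis p_gt0 : 0 < p.
Hypothesis p_lt1 : p < 1.
Let q : R := 1 - p.
Let q_gt0 : 0 < q. Proof. by rewrite subr_gt0. Qed.
Let p_ge0 : 0 <= p. Proof. exact: ltW. Qed.
Let q_ge0 : 0 <= q. Proof. exact: ltW. Qed.
Let p01 : 0 <= p <= 1. Proof. by rewrite !ltW. Qed.

(** For s = t + 2i and s <= n this is the weight of the Frankl family F^t_i. *)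
Definition tail s i : R := mu p s (fun w => (s <= count id w + i)%N).

Lemma mu_take n s P : (s <= n)%N -> mu p n (fun w => P (take s w)) = mu p s P.
Proof.
move=> sn; rewrite -{1}(subnKC sn) -[RHS]mulr1 -(@mu_predT _ p (n - s) xpredT) //.
by rewrite -mu_cat; apply: eq_mu => w _; rewrite andbT.
Qed.

Lemma mu_drop n s P : (s <= n)%N -> mu p n (fun w => P (drop s w)) = mu p (n - s) P.
Proof.
move=> sn; rewrite -{1}(subnKC sn) -[RHS]mul1r -(@mu_predT _ p s xpredT) //.
by rewrite -mu_cat; apply: eq_mu => w _.
Qed.

Lemma mu_tall n s i : (s <= n)%N -> mu p n (tall s i) = tail s i.
Proof. exact: mu_take. Qed.

(* Walks with all [i] failures among the first [t] steps. *)
Let early t i (x : seq bool) := (count id (take t x) + i == t)%N && all id (drop t x).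

Lemma mu_early t i j :
  mu p (t + j) (early t i) = 'C(t, i)%:R * p ^+ (t + j - i) * q ^+ i.
Proof.
rewrite /early (mu_cat _ _ _ (fun x => count id x + i == t)%N) mu_count.
have [it|ti] := leqP i t; last by rewrite bin_small // !mul0r.
have -> : mu p j (all id) = p ^+ j.
  have := mu_count p j 0; rewrite bin0 subn0 expr0 mul1r mulr1 => <-.
  by apply: eq_mu => w sw; rewrite all_count sw addn0.
by rewrite addnC -addnBA // exprD; ring.
Qed.

(** [dl] is the measure of the continuations that A misses behind every early prefix. Early words
    have exactly k - i ups at each time k from [t] to s = t + i + j, so a word of B outside its
    threshold family can satisfy the cross condition with them only after time s. *)
Lemma loss_and_gain n t i j (A B : pred (seq bool)) (k : R) : p <= q ->
  (t + i + j <= n)%N -> (i <= t)%N -> (j <= t + i)%N -> walk_cross t n A B ->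
  (forall Y, size Y = n -> B Y -> hit (t + i - j).+1 Y || tall (t + i + j) j Y) ->
  0 <= k ->
  p ^+ (t + i - j).+1 <= k * tail (t + i + j) j * q ^+ (2 * (t + i - j) + 3) ->
  exists2 dl : R, 0 <= dl <= 1 &
    mu p n (fun w => A w && tall (t + i + j) i w) <=
      tail (t + i + j) i - 'C(t, i)%:R * p ^+ (t + j) * q ^+ i * dl /\
    mu p n (fun w => B w && ~~ tall (t + i + j) j w) <= k * tail (t + i + j) j * dl.
Proof.
move=> pq sn it jt cross hB k0 num; set s := (t + i + j)%N in sn hB num *.
set m := (n - s)%N.
(* At time s an early prefix has s - i ups and a word of B that is not tall at most s - j - 1. As s
   = t + i + j, the continuations must make up a strict excess, hence the [<] in [U]. *)
pose W w := `[< exists2 x, size x = s & early t i x && A (x ++ w) >].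
pose U V := `[< forall w, size w = m -> W w ->
  exists2 k, (k <= m)%N & (k < count id (take k w) + count id (take k V))%N >].
have UW w : size w = m -> ~~ (U (map negb w) && W w).
  move=> sw; apply/negP => /andP[/asboolP Uw Ww].
  have [l lm] := Uw w sw Ww; rewrite -map_take count_map.
  have -> : count (preim negb id) (take l w) = count (predC id) (take l w) by [].
  by rewrite count_predC size_takel ?sw // ltnn.
have Uup x y : U (x ++ false :: y) -> U (x ++ true :: y).
  move=> /asboolP Ux; apply/asboolP => w sw Ww.
  have [l lm h] := Ux w sw Ww; exists l => //; apply: leq_trans h _.
  rewrite leq_add2l !take_cat; case: ltnP => // _; rewrite !count_cat leq_add2l.
  by case: (l - size x)%N => //= ?; rewrite leq_add2r.
have BU Y : size Y = n -> B Y -> ~~ tall s j Y -> U (drop s Y).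
  move=> sY BY ntY; apply/asboolP => w sw /asboolP[x sx /andP[/andP[/eqP x1 x2] Axw]].
  have sxw : size (x ++ w) = n by rewrite size_cat sx sw subnKC.
  have [l ln hl] := cross _ _ sxw sY Axw BY.
  have xs l' : (t <= l' <= s)%N -> (count id (take l' x) + i = l')%N.
    move=> /andP[tl ls]; rewrite -(subnKC tl) takeD count_cat.
    have /allP all1 := x2; have -> : count id (take (l' - t) (drop t x)) = (l' - t)%N.
      apply/eqP; rewrite -[X in _ == X](@size_takel _ _ (drop t x)) ?size_drop ?sx ?leq_sub2r //.
      by rewrite -all_count; apply/allP => b /mem_take; apply: all1.
    by move: x1; clear; lia.
  have [ls|sl] := leqP l s.
    exfalso; move: hl; rewrite take_cat sx.
    have -> : (if (l < s)%N then take l x else x ++ take (l - s) w) = take l x.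
      by case: ltnP => // sl; rewrite (_ : l = s) ?subnn ?take0 ?cats0 ?take_oversize ?sx //;
        apply/eqP; rewrite eqn_leq ls.
    (* Before [t] the ups total at most 2l < l + t. From [t] to [s] the condition would give [Y] at
       least t + i = s - j ups by time [s], making it tall. *)
    have [lt|tl] := ltnP l t.
      have := count_take_le l x; have := count_take_le l Y.
      by move: lt; clear; lia.
    have := xs l; rewrite tl ls => /(_ isT).
    have /andP[+ _] := count_take_mono Y ls.
    move: ntY; rewrite /tall -/s. rewrite /s; clear; lia.
  exists (l - s)%N; first by rewrite leq_sub2r.
  have ts : (t <= s)%N by rewrite /s -addnA leq_addr.
  have := xs s; rewrite ts leqnn take_oversize ?sx // => /(_ isT).
  move: hl; rewrite take_cat sx ltnNge (ltnW sl) /= count_cat.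
  have -> : take l Y = take s Y ++ take (l - s) (drop s Y).
    by rewrite -takeD subnKC // ltnW.
  rewrite count_cat.
  by move: ntY sl; rewrite /tall -/s /s; clear; lia.
have dl01 : 0 <= 1 - mu p m W <= 1.
  by rewrite subr_ge0 mu_le1 //= gerBl mu_ge0.
exists (1 - mu p m W) => //; split.
  set E := _ * _ * q ^+ i; pose G x := (s <= count id x + i)%N && ~~ early t i x.
  have muE : mu p s (early t i) = E.
    have e : (t + (i + j) - i = t + j)%N by clear; lia.
    by rewrite /s -addnA mu_early e.
  have earlyP x : size x = s -> early t i x -> (s <= count id x + i)%N.
    move=> sx /andP[/eqP x1 x2]; rewrite -(cat_take_drop t x) count_cat.
    have -> : count id (drop t x) = (s - t)%N.
      by apply/eqP; rewrite -sx -size_drop -all_count.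
    by move: x1; rewrite /s; clear; lia.
  have muG : mu p s G = tail s i - E.
    have eq1 : mu p s (fun w => (s <= count id w + i)%N && early t i w) = E.
      rewrite -muE; apply: eq_mu => x sx.
      by case h: (early t i x); rewrite ?andbF // andbT; apply: earlyP.
    have := mu_split p s (fun w => (s <= count id w + i)%N) (early t i).
    by rewrite eq1 => e1; rewrite /tail e1 addrC addKr.
  apply: (@le_trans _ _ (mu p n (fun w => G (take s w)) +
     mu p n (fun w => early t i (take s w) && W (drop s w)))).
    apply: mu_le_split => // w sw /andP[Aw tw]; rewrite /G.
    case h: (early t i (take s w)); rewrite /= ?andbT ?andbF ?orbF //=.
    apply/asboolP; exists (take s w); first by rewrite size_takel ?sw.
    by rewrite h cat_take_drop.
  rewrite mu_take // muG -[in X in _ + mu p X _](subnKC sn) mu_cat muE -/m.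
  by rewrite le_eqVlt; apply/orP; left; apply/eqP; ring.
have muBU : mu p n (fun w => B w && ~~ tall s j w) <= mu p m U.
  rewrite -(mu_drop U sn); apply: mu_le => // w sw /andP[Bw]; exact: BU.
have /andP[dl0 _] := dl01.
apply: (@gain_le_loss R p p_gt0 p_lt1 _ _ _ _ (t + i - j) pq dl0 _ k0 _ _ num).
- by rewrite mu_ge0.
- apply: le_trans (mu_hit p_gt0 p_lt1 n _); apply: mu_le => // Y sY /andP[BY ntY].
  by have := hB Y sY BY; rewrite (negbTE ntY) orbF.
move=> r pr; apply: (le_trans muBU).
have q01 : 0 <= q <= 1 by rewrite q_ge0 gerBl.
apply: (le_trans (mu_upset_pow m p_ge0 q01 pr Uup)).
rewrite lerXn2r ?nnegrE ?mu_ge0 //.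
(* The q-measure of [U] is the p-measure of its complements; these are disjoint from [W], so they
   weigh at most 1 - mu W, the loss. *)
rewrite mu_compl subKr lerBrDr.
rewrite -mu_orD ?mu_le1 // => w sw; exact: UW.
Qed.

(** Let x and y be the losses of A and B. A loss costs its own family at least 9/10 of it in
    relative weight, 9/10 bounding the share of early words, and gives the other family at most 4/5
    of it. So the product drops by a fraction (x + y)/20 at least, and equality forces both losses
    to vanish. *)
Lemma near_extremal n t i j (A B : pred (seq bool)) : p <= q ->
  (t + i + j <= n)%N -> (i <= t)%N -> (j <= t)%N -> walk_cross t n A B ->
  (forall X, size X = n -> A X -> hit (t + j - i).+1 X || tall (t + i + j) i X) ->
  (forall Y, size Y = n -> B Y -> hit (t + i - j).+1 Y || tall (t + i + j) j Y) ->
  p ^+ (t + j - i).+1 <= 4 / 5 * tail (t + i + j) i * q ^+ (2 * (t + j - i) + 3) ->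
  p ^+ (t + i - j).+1 <= 4 / 5 * tail (t + i + j) j * q ^+ (2 * (t + i - j) + 3) ->
  9 / 10 * tail (t + i + j) i <= 'C(t, i)%:R * p ^+ (t + j) * q ^+ i ->
  9 / 10 * tail (t + i + j) j <= 'C(t, j)%:R * p ^+ (t + i) * q ^+ j ->
  mu p n A * mu p n B <= tail (t + i + j) i * tail (t + i + j) j /\
  (mu p n A * mu p n B = tail (t + i + j) i * tail (t + i + j) j ->
   forall w, size w = n -> A w = tall (t + i + j) i w /\ B w = tall (t + i + j) j w).
Proof.
move=> pq sn it jt cross hA hB numA numB gA gB.
have k0 : 0 <= 4 / 5 :> R by lra.
have tji : (t + j + i = t + i + j)%N by rewrite addnAC.
have crossC : walk_cross t n B A.
  by move=> X Y sX sY BX AY; have [k kn h] := cross Y X sY sX AY BX;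
    exists k => //; rewrite [leqRHS]addnC.
have [x /andP[x0 x1] [a1 b2]] := loss_and_gain pq sn it (leq_trans jt (leq_addr _ _)) cross hB
  k0 numB.
have := @loss_and_gain n t j i B A (4 / 5) pq; rewrite tji.
move=> /(_ sn jt (leq_trans it (leq_addr _ _)) crossC hA k0 numA) [y /andP[y0 y1] [b1 a2]].
have eA := mu_split p n A (tall (t + i + j) i).
have eB := mu_split p n B (tall (t + i + j) j).
have pos F k l : p ^+ k <= 4 / 5 * F * q ^+ l -> 0 < F.
  move=> /(lt_le_trans (exprn_gt0 k p_gt0)); rewrite pmulr_lgt0 ?exprn_gt0 // pmulr_rgt0 //; lra.
have FA := pos _ _ _ numA; have FB := pos _ _ _ numB.
have gx := ler_wpM2r x0 gA; have gy := ler_wpM2r y0 gB.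
have := mu_tall i sn; have := mu_tall j sn.
have a20 := mu_ge0 n (fun w => A w && ~~ tall (t + i + j) i w) p01.
have b20 := mu_ge0 n (fun w => B w && ~~ tall (t + i + j) j w) p01.
have a10 := mu_ge0 n (fun w => A w && tall (t + i + j) i w) p01.
have b10 := mu_ge0 n (fun w => B w && tall (t + i + j) j w) p01.
set FA' := tail _ i in FA gA gx a1 a2 *; set FB' := tail _ j in FB gB gy b1 b2 *.
set A1 := mu p n (fun w => A w && tall _ i w) in eA a1 a10 *.
set A2 := mu p n (fun w => A w && ~~ tall _ i w) in eA a2 a20 *.
set B1 := mu p n (fun w => B w && tall _ j w) in eB b1 b10 *.
set B2 := mu p n (fun w => B w && ~~ tall _ j w) in eB b2 b20 *.
move=> tB tA.
have leA : mu p n A <= FA' * (1 - 9 / 10 * x + 4 / 5 * y) by lra.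
have leB : mu p n B <= FB' * (1 - 9 / 10 * y + 4 / 5 * x) by lra.
have prod : mu p n A * mu p n B <= FA' * FB' * (1 - (x + y) / 20).
  apply: (le_trans (ler_pM (mu_ge0 _ _ p01) (mu_ge0 _ _ p01) leA leB)).
  have xx : x * x <= x by rewrite ler_piMr.
  have yy : y * y <= y by rewrite ler_piMr.
  (* The second-order part of the product is -(18/25)(x - y)^2 + xy/100; the last term is absorbed
     by the slack (x + y)/20. *)
  have := sqr_ge0 (x - y); rewrite expr2 => xy.
  by rewrite mulrACA ler_wpM2l ?mulr_ge0 ?(ltW FA) ?(ltW FB) //; lra.
have FAB : 0 < FA' * FB' by rewrite mulr_gt0.
split=> [|eq].
  by apply: (le_trans prod); rewrite ger_pMr //; lra.
have xy : (x + y) <= 0.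
  by move: prod; rewrite eq ler_pMr //; lra.
have [x00 y00] : x = 0 /\ y = 0 by split; lra.
move: a1 a2 b1 b2; rewrite x00 y00 !mulr0 !subr0 => a1 a2 b1 b2.
have A20 : A2 = 0 by lra.
have B20 : B2 = 0 by lra.
have A1F : A1 = FA'.
  apply/eqP; rewrite eq_le a1 /= -(ler_pM2r FB) -eq eA eB A20 B20 !addr0.
  by rewrite ler_wpM2l.
have B1F : B1 = FB'.
  by move: eq; rewrite eA eB A20 B20 !addr0 A1F => /(mulfI (lt0r_neq0 FA)).
have pp : 0 < p < 1 by rewrite p_gt0.
have leA1 : mu p n (tall (t + i + j) i) <= A1 by rewrite tA A1F.
have leB1 : mu p n (tall (t + i + j) j) <= B1 by rewrite tB B1F.
have leA2 : A2 <= 0 by rewrite A20.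
have leB2 : B2 <= 0 by rewrite B20.
have subA w : size w = n -> A w && tall (t + i + j) i w -> tall (t + i + j) i w.
  by move=> _ /andP[].
have subB w : size w = n -> B w && tall (t + i + j) j w -> tall (t + i + j) j w.
  by move=> _ /andP[].
move=> w sw; split.
- rewrite -(mu_inj pp subA leA1 sw).
  by move: (mu_eq0 pp leA2 sw); case: (A w) => //=; case: tall.
- rewrite -(mu_inj pp subB leB1 sw).
  by move: (mu_eq0 pp leB2 sw); case: (B w) => //=; case: tall.
Qed.
End NearExtremal.

(** * Numerical estimates *)

(** This is the case a = j = 1 after division by p^(2t+2), where X = (t + 2) q + p and f1 = p^(t+1)
    X. As p X >= 1, the part X (p X - (1 - p)^2) of the difference is at least about 2 p X, against
    about p X subtracted. *)
Lemma off_diag_poly (R : realFieldType) (p X : R) :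
  0 < p -> p <= 1 / 100 -> 198 <= X -> 1 <= p * X ->
  ((1 - p) * X + p * (1 - p + p ^+ 2)) * (X + (1 - p)) < X ^+ 2.
Proof.
move=> p0 ps X0 phi.
have pp : p ^+ 2 <= 1 / 100.
  by have := ler_pM (ltW p0) (ltW p0) ps ps; rewrite expr2; lra.
have pp0 : 0 <= p ^+ 2 by rewrite exprn_ge0 // ltW.
have pX : X <= p * X * X by rewrite -[leLHS]mul1r ler_wpM2r //; lra.
have h3 : p * (1 - p + p ^+ 2) * (X + (1 - p)) <= p * (1 - p + 1 / 100) * (X + 1).
  have pq0 : 0 <= p * (1 - p + p ^+ 2) by rewrite mulr_ge0; lra.
  apply: ler_pM => //; [lra| |lra].
  by rewrite ler_wpM2l ?lerD2l // ltW.
have h4 : p * 198 <= p * X by rewrite ler_wpM2l // ltW.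
have h5 : 0 <= p * p by rewrite mulr_ge0 // ltW.
rewrite -subr_gt0.
have -> : X ^+ 2 - ((1 - p) * X + p * (1 - p + p ^+ 2)) * (X + (1 - p)) =
   p * X * X - (1 - p) ^+ 2 * X - p * (1 - p + p ^+ 2) * (X + (1 - p)) by ring.
rewrite expr2; lra.
Qed.

Section Estimates.
Variables (R : realType) (t : nat) (p : R).
Hypothesis t200 : (200 <= t)%N.
Hypothesis p_ge : 1 <= p * (t%:R + 1).
Hypothesis p_le : p * (t%:R + 3) <= 2.
Let q : R := 1 - p.
Let al : R := p / q.
Local Notation T := (t%:R : R).

Let T200 : 200 <= T. Proof. by rewrite (ler_nat R 200). Qed.
Let p_gt0 : 0 < p.
Proof.
have T1 : 0 < T + 1 by have := T200; lra.
by rewrite -(pmulr_lgt0 _ T1); apply: lt_le_trans p_ge.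
Qed.
Let p_small : p <= 1 / 100.
Proof. have := ler_wpM2l (ltW p_gt0) T200; move: p_le; lra. Qed.
Let q_gt0 : 0 < q. Proof. by move: p_small; rewrite /q; lra. Qed.
Let q_le1 : q <= 1. Proof. by move: p_gt0; rewrite /q; lra. Qed.
Let p_ge0 : 0 <= p. Proof. exact: ltW. Qed.
Let q_ge0 : 0 <= q. Proof. exact: ltW. Qed.

Lemma expr_ge_chain (x y : R) k l : 0 <= y -> y <= x ^+ k -> y ^+ l <= x ^+ (k * l).
Proof. by move=> y0 h; rewrite exprM lerXn2r ?nnegrE ?(le_trans y0). Qed.

(* Since [e^(-1/50) >= 49/50], these are lower bounds for [e^(-4)] and [e^(-4.06)], the
   limits of [q^(2 t + c)] at the right end [p = 2/(t+3)]. *)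
Lemma pow_49_50 : 1 / 57 <= (49 / 50) ^+ 200 :> R /\ 1 / 61 <= (49 / 50) ^+ 203 :> R.
Proof.
set x : R := 49 / 50.
(* Each fraction of small height lies just below the square of the preceding one; 200 = 128 + 64 +
   8. *)
have x8 : 57 / 67 <= x ^+ 8 by rewrite /x !exprS expr0; lra.
have x16 : 131 / 181 <= x ^+ 16.
  by apply: le_trans (@expr_ge_chain x _ 8 2 _ x8); rewrite ?expr2; lra.
have x32 : 11 / 21 <= x ^+ 32.
  by apply: le_trans (@expr_ge_chain x _ 16 2 _ x16); rewrite ?expr2; lra.
have x64 : 76 / 277 <= x ^+ 64.
  by apply: le_trans (@expr_ge_chain x _ 32 2 _ x32); rewrite ?expr2; lra.
have x128 : 7 / 93 <= x ^+ 128.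
  by apply: le_trans (@expr_ge_chain x _ 64 2 _ x64); rewrite ?expr2; lra.
have x192 : (7 / 93) * (76 / 277) <= x ^+ 192.
  have -> : x ^+ 192 = x ^+ 128 * x ^+ 64 by rewrite -exprD.
  by apply: ler_pM => //; lra.
have x200 : (7 / 93) * (76 / 277) * (57 / 67) <= x ^+ 200.
  have -> : x ^+ 200 = x ^+ 192 * x ^+ 8 by rewrite -exprD.
  by apply: ler_pM => //; lra.
split; first lra.
have -> : x ^+ 203 = x ^+ 200 * x ^+ 3 by rewrite -exprD.
have x3 : 94 / 100 <= x ^+ 3 by rewrite /x !exprS expr0; lra.
apply: (@le_trans _ _ ((7 / 93) * (76 / 277) * (57 / 67) * (94 / 100))); first lra.
by apply: ler_pM => //; lra.
Qed.

(** (t+1)/(t+3) is 1 - p at the right end. Exponentials separate the two sides: its inverse 1 +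
    2/(t+1) is at most exp(2/(t+1)), and exp(1/50) is at most 50/49. *)
Lemma q0_pow m k : 2 * m%:R * 50 <= k%:R * (T + 1) ->
  (49 / 50) ^+ k <= ((T + 1) / (T + 3)) ^+ m.
Proof.
move=> mk; have T1 : 0 < T + 1 by have := T200; lra.
have T3 : 0 < T + 3 by have := T200; lra.
rewrite -[leLHS]invrK -[leRHS]invrK lef_pV2 ?posrE ?invr_gt0 ?exprn_gt0 ?divr_gt0 //.
rewrite -!exprVn.
apply: (@le_trans _ _ (expR (2 / (T + 1)) ^+ m)).
  have iqE : ((T + 1) / (T + 3))^-1 = 1 + 2 / (T + 1).
    by field; rewrite !gt_eqF.
  rewrite lerXn2r ?nnegrE ?expR_ge0 // iqE ?expR_ge1Dx //.
  by rewrite addr_ge0 ?divr_ge0 // ltW.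
have e50 : expR (1 / 50) <= (49 / 50)^-1 :> R.
  rewrite -[leLHS]invrK lef_pV2 ?posrE ?invr_gt0 ?expR_gt0 //; last by lra.
  by rewrite -expRN; apply: le_trans (expR_ge1Dx _); lra.
apply: (@le_trans _ _ (expR (1 / 50) ^+ k)).
  rewrite -!expRM_natl ler_expR mulrA ler_pdivrMr //; move: mk.
  by lra.
by rewrite lerXn2r ?nnegrE ?expR_ge0 // invr_ge0; lra.
Qed.

Lemma q_pow61 m : (m <= 2 * t + 7)%N -> 1 / 61 <= q ^+ m.
Proof.
move=> mt; have T3 : 0 < T + 3 by have := T200; lra.
have le : q ^+ (2 * t + 7) <= q ^+ m by rewrite ler_wiXn2l.
apply: le_trans le; have [_ le] := pow_49_50; apply: (le_trans le).
apply: le_trans (@q0_pow (2 * t + 7) 203 _) _.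
  by rewrite natrD natrM; have := T200; lra.
rewrite lerXn2r ?nnegrE // ?divr_ge0 //; first by have := T200; lra.
  exact: ltW.
by rewrite ler_pdivrMr // /q; move: p_le; lra.
Qed.

(* [p |-> p (1-p)^m] is decreasing here, so its minimum is at [p = 2/(t+3)]. *)
Lemma pq_pow_ge : 69 / 10 <= T ^+ 2 * p * q ^+ (2 * t + 1).
Proof.
have T3 : 0 < T + 3 by have := T200; lra.
set p0 := 2 / (T + 3); set q0 := (T + 1) / (T + 3).
have q00 : 0 < q0 by rewrite divr_gt0 //; have := T200; lra.
have q0E : q0 = 1 - p0 by rewrite /q0 /p0; field; rewrite gt_eqF.
have pp0 : p <= p0 by rewrite /p0 ler_pdivlMr.
have ber m (y : R) : 0 <= y -> 1 + m%:R * y <= (1 + y) ^+ m.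
  move=> y0; elim: m => [|m IH]; first by rewrite mul0r addr0.
  rewrite exprS; apply: (@le_trans _ _ ((1 + y) * (1 + m%:R * y))).
    have : 0 <= m%:R * y * y :> R by rewrite !mulr_ge0.
    by rewrite -natr1; nra.
  by rewrite ler_wpM2l // addr_ge0.
set m := (2 * t + 1)%N.
(* Bernoulli replaces the derivative: q = q0 (1 + (p0 - p)/q0), and the first-order term suffices
   because m p >= 1 >= q0. *)
have mono : p0 * q0 ^+ m <= p * q ^+ m.
  have y0 : 0 <= (p0 - p) / q0 by rewrite divr_ge0 ?subr_ge0 // ltW.
  have qq : q = q0 * (1 + (p0 - p) / q0) by rewrite q0E /q; field; rewrite -q0E gt_eqF.
  have -> : p * q ^+ m = q0 ^+ m * (p * (1 + (p0 - p) / q0) ^+ m).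
    by rewrite qq exprMn; ring.
  rewrite [leLHS]mulrC ler_wpM2l ?exprn_ge0 ?(ltW q00) //.
  apply: (@le_trans _ _ (p * (1 + m%:R * ((p0 - p) / q0)))).
    rewrite -subr_ge0.
    have -> : p * (1 + m%:R * ((p0 - p) / q0)) - p0 = (p0 - p) * (m%:R * p - q0) / q0.
      by field; rewrite gt_eqF.
    rewrite divr_ge0 ?(ltW q00) // mulr_ge0 ?subr_ge0 //.
    apply: (@le_trans _ _ 1); first by rewrite /q0 ler_pdivrMr //; lra.
    apply: le_trans p_ge _; rewrite mulrC ler_wpM2r // /m natrD natrM; have := T200; lra.
  by rewrite ler_wpM2l // ber.
have [le57 _] := pow_49_50.
have q57 : 1 / 57 <= q0 ^+ m.
  apply: (le_trans le57); apply: q0_pow; rewrite /m natrD natrM; have := T200; lra.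
(* 2 t^2 / (57 (t + 3)) increases with t and is about 6.91 at t = 200, whence the constant 69/10. *)
rewrite -mulrA; apply: (@le_trans _ _ (T ^+ 2 * (p0 * (1 / 57)))).
  have -> : T ^+ 2 * (p0 * (1 / 57)) = T * T * (2 / 57) / (T + 3).
    by rewrite /p0; field; rewrite gt_eqF.
  rewrite ler_pdivlMr //; have : 200 * T <= T * T by rewrite ler_wpM2r.
  have := T200; lra.
rewrite ler_wpM2l ?exprn_ge0 //; apply: le_trans mono.
by rewrite ler_wpM2l // divr_ge0 // ltW.
Qed.

Let f1 : R := (T + 2) * p ^+ (t + 1) * q + p ^+ (t + 2).

Let f1E : f1 = p ^+ t * (p * ((T + 2) * q + p)).
Proof. by rewrite /f1 !exprD expr1 expr2; ring. Qed.

Let f1_ge : p ^+ t * (T * p) <= f1.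
Proof.
rewrite f1E ler_wpM2l ?exprn_ge0 // mulrC ler_wpM2l // /q.
by move: p_le (T200) (p_ge0); lra.
Qed.

(** This factor is f1 / p^t, the ratio of the weights of F^t_1 and F^t_0; the left end of the range
    of p makes it at least 1. *)
Let phi_ge1 : 1 <= p * ((T + 2) * q + p).
Proof.
rewrite -subr_ge0 (_ : _ - 1 = (p * (T + 1) - 1) * q); last by rewrite /q; ring.
by rewrite mulr_ge0 // subr_ge0.
Qed.

Let f1_gt0 : 0 < f1.
Proof. by rewrite f1E mulr_gt0 ?exprn_gt0 // (lt_le_trans ltr01). Qed.

Lemma f1_sqr_ge : p ^+ (2 * t) * (T * p) ^+ 2 <= f1 ^+ 2.
Proof.
have T0 : 0 <= T * p by rewrite mulr_ge0 // (le_trans _ T200).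
rewrite mulnC exprM -exprMn lerXn2r ?nnegrE ?(ltW f1_gt0) //.
by rewrite mulr_ge0 ?exprn_ge0.
Qed.

(** Any part of the product of size al^(2t+1) thus takes at most 1/6.9 of the target. *)
Lemma crude_bound : 69 / 10 * al ^+ (2 * t + 1) <= f1 ^+ 2.
Proof.
apply: le_trans f1_sqr_ge; rewrite /al expr_div_n mulrA ler_pdivrMr ?exprn_gt0 //.
have h := pq_pow_ge.
have -> : p ^+ (2 * t) * (T * p) ^+ 2 * q ^+ (2 * t + 1) =
  T ^+ 2 * p * q ^+ (2 * t + 1) * p ^+ (2 * t + 1).
  by rewrite exprMn [p ^+ (2 * t + 1)]exprD expr1; ring.
by rewrite ler_wpM2r ?exprn_ge0.
Qed.

Lemma tailS s i : tail p s i.+1 = tail p s i + 'C(s, i.+1)%:R * p ^+ (s - i.+1) * q ^+ i.+1.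
Proof.
rewrite /tail -mu_count -mu_orD => [|w sw].
  by apply: eq_mu => w sw; clear; lia.
by clear; lia.
Qed.

Lemma tail0 s : tail p s 0 = p ^+ s.
Proof.
have := mu_count p s 0; rewrite bin0 subn0 expr0 mul1r mulr1 => <-.
apply: eq_mu => w sw; have := count_size id w; rewrite sw.
by clear; lia.
Qed.

Let pq_le : p * q <= 2 * (T + 1) / (T + 3) ^+ 2.
Proof.
have T3 : 0 < T + 3 by move: T200; lra.
have p0 : p <= 2 / (T + 3) by rewrite ler_pdivlMr.
have p1 : 2 / (T + 3) <= 1 / 2 by rewrite ler_pdivrMr //; move: T200; lra.
have -> : 2 * (T + 1) / (T + 3) ^+ 2 = 2 / (T + 3) * (1 - 2 / (T + 3)).
  by field; rewrite gt_eqF.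
move: p0 p1 p_small; rewrite /q; set x := 2 / (T + 3) => p0 p1 ps.
have : 0 <= (x - p) * (1 - p - x) by rewrite mulr_ge0 //; lra.
by lra.
Qed.

(** Up to the factor p^(2t), the probability that two independent walks are at levels t - a and t +
    a at time t + a + 2j. *)
Let G a j : R := 'C(t + a + 2 * j, a + j)%:R * 'C(t + a + 2 * j, j)%:R * (p * q) ^+ (a + 2 * j).

Let z_ge0 : 0 <= p * q. Proof. exact: mulr_ge0. Qed.
Let z_le : p * q * (T + 3) <= 2.
Proof.
apply: le_trans p_le; rewrite ler_wpM2r //; first by move: T200; lra.
by rewrite ler_piMr.
Qed.

(** With k = a + j the ratio is (s + 1)^2 p q / ((k + 1)(t + k + 1)); p q <= 2/(t+3) and s <= t + 2k
    make it at most 1 from k = 2 on. *)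
Let G_step_a a j : (2 <= a + j)%N -> G a.+1 j <= G a j.
Proof.
move=> aj; rewrite /G; set s := (t + a + 2 * j)%N.
have -> : (t + a.+1 + 2 * j = s.+1)%N by rewrite /s; clear; lia.
rewrite !addSn exprS; set k := (a + j)%N in aj *.
have d1 : (k.+1%:R : R) * 'C(s.+1, k.+1)%:R = s.+1%:R * 'C(s, k)%:R.
  by rewrite -!natrM -mul_bin_diag.
have d2 : ((t + k).+1%:R : R) * 'C(s.+1, j)%:R = s.+1%:R * 'C(s, j)%:R.
  have -> : ((t + k).+1 = s.+1 - j)%N by rewrite /s /k; clear; lia.
  by rewrite -!natrM -mul_bin_down.
set X' := 'C(s.+1, k.+1)%:R in d1 *; set Y' := 'C(s.+1, j)%:R in d2 *.
set X := 'C(s, k)%:R in d1 *; set Y := 'C(s, j)%:R in d2 *.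
have XY : 0 <= X * Y by rewrite mulr_ge0 ?ler0n.
have -> : X' * Y' * (p * q * (p * q) ^+ (a + 2 * j)) =
   X' * Y' * (p * q) * (p * q) ^+ (a + 2 * j) by ring.
rewrite ler_wpM2r ?exprn_ge0 //.
have k0 : 0 < (k.+1%:R : R) * (t + k).+1%:R by rewrite mulr_gt0 ?ltr0n.
rewrite -(ler_pM2l k0).
have -> : k.+1%:R * (t + k).+1%:R * (X' * Y' * (p * q)) =
   (k.+1%:R * X') * ((t + k).+1%:R * Y') * (p * q) by ring.
rewrite d1 d2.
have -> : s.+1%:R * X * (s.+1%:R * Y) * (p * q) = (s.+1%:R ^+ 2 * (p * q)) * (X * Y) by ring.
rewrite ler_wpM2r //.
have T3 : 0 < T + 3 by move: T200; lra.
have k2 : 2 <= k%:R :> R by rewrite (ler_nat R 2).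
have sk : s.+1%:R <= T + 2 * k%:R + 1.
  by rewrite -natrM -natrD -natr1 lerD2r ler_nat /s /k; clear; lia.
have sk2 : s.+1%:R ^+ 2 <= (T + 2 * k%:R + 1) ^+ 2.
  by rewrite lerXn2r ?nnegrE // addr_ge0 // addr_ge0 ?mulr_ge0.
rewrite -(ler_pM2r T3) -mulrA.
apply: (@le_trans _ _ ((T + 2 * k%:R + 1) ^+ 2 * 2)).
  by rewrite ler_pM ?exprn_ge0 // mulr_ge0 // ltW.
rewrite -(natr1 k) -(natr1 (t + k)) natrD; set K := k%:R in k2 *.
have := T200; set S := T => S200.
have -> : (K + 1) * (S + K + 1) * (S + 3) = (S + 2 * K + 1) ^+ 2 * 2 +
   ((K - 2) * (S * (S - 3)) + S * (S - 6) + K ^+ 2 * (S - 5) + (1 - 2 * K)).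
  by ring.
rewrite lerDl.
have h1 : 0 <= (K - 2) * (S * (S - 3)) by rewrite !mulr_ge0 //; lra.
have h2 : 0 <= S * (S - 6) by rewrite mulr_ge0 //; lra.
have h3 : K * 195 <= K ^+ 2 * (S - 5).
  have K0 : 0 <= K by lra.
  rewrite expr2 -mulrA ler_wpM2l //.
  apply: (@le_trans _ _ (1 * (S - 5))); first lra.
  by rewrite ler_wpM2r; lra.
lra.
Qed.

(** For a = 0 the two binomials agree and the term is a square, so it is enough to compare square
    roots. *)
Let G_step_j j : (3 <= j)%N -> G 0 j.+1 <= G 0 j.
Proof.
move=> j3; rewrite /G !add0n !addn0; set s := (t + 2 * j)%N.
have -> : (t + 2 * j.+1 = s.+2)%N by rewrite /s; clear; lia.
rewrite !mul2n -!addnn !exprD.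
have sq (c : R) k : c * c * ((p * q) ^+ k * (p * q) ^+ k) = (c * (p * q) ^+ k) ^+ 2 by ring.
rewrite !sq lerXn2r ?nnegrE ?mulr_ge0 ?exprn_ge0 ?ler0n //.
rewrite exprS mulrA ler_wpM2r ?exprn_ge0 //.
have d1 : (j.+1%:R : R) * 'C(s.+2, j.+1)%:R = s.+2%:R * 'C(s.+1, j)%:R.
  by rewrite -!natrM -mul_bin_diag.
have d2 : ((t + j).+1%:R : R) * 'C(s.+1, j)%:R = s.+1%:R * 'C(s, j)%:R.
  have -> : ((t + j).+1 = s.+1 - j)%N by rewrite /s; clear; lia.
  by rewrite -!natrM -mul_bin_down.
set X'' := 'C(s.+2, j.+1)%:R in d1 *; set X' := 'C(s.+1, j)%:R in d1 d2.
set X := 'C(s, j)%:R in d2 *.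
have X0 : 0 <= X by rewrite ler0n.
have k0 : 0 < (j.+1%:R : R) * (t + j).+1%:R by rewrite mulr_gt0 ?ltr0n.
rewrite -(ler_pM2l k0).
have -> : j.+1%:R * (t + j).+1%:R * (X'' * (p * q)) =
   (j.+1%:R * X'') * ((t + j).+1%:R * (p * q)) by ring.
rewrite d1.
have -> : s.+2%:R * X' * ((t + j).+1%:R * (p * q)) =
   s.+2%:R * ((t + j).+1%:R * X') * (p * q) by ring.
rewrite d2.
have -> : s.+2%:R * (s.+1%:R * X) * (p * q) = s.+2%:R * s.+1%:R * (p * q) * X by ring.
rewrite ler_wpM2r //.
have T3 : 0 < T + 3 by move: T200; lra.
have j3' : 3 <= j%:R :> R by rewrite (ler_nat R 3).
have sE : s%:R = T + 2 * j%:R :> R by rewrite natrD natrM.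
rewrite -(ler_pM2r T3).
apply: (@le_trans _ _ (s.+2%:R * s.+1%:R * 2)).
  by rewrite -[leLHS]mulrA; apply: ler_wpM2l z_le; rewrite mulr_ge0 ?ler0n.
rewrite -(natr1 s.+1) -(natr1 s) sE -(natr1 j) -(natr1 (t + j)) natrD.
set J := j%:R in j3' *; have := T200; set S := T => S200.
have -> : (J + 1) * (S + J + 1) * (S + 3) = (S + 2 * J + 1 + 1) * (S + 2 * J + 1) * 2 +
   ((J - 3) * (S * (S - 3)) + S * (2 * S - 11) + J ^+ 2 * (S - 5) + (- 6 * J - 1)).
  by ring.
rewrite lerDl.
have h1 : 0 <= (J - 3) * (S * (S - 3)) by rewrite !mulr_ge0 //; lra.
have h2 : 0 <= S * (2 * S - 11) by rewrite mulr_ge0 //; lra.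
have h3 : J * 195 <= J ^+ 2 * (S - 5).
  have J0 : 0 <= J by lra.
  rewrite expr2 -mulrA ler_wpM2l //.
  apply: (@le_trans _ _ (1 * (S - 5))); first lra.
  by rewrite ler_wpM2r; lra.
lra.
Qed.

Lemma bin2R s : 'C(s.+1, 2)%:R = (s%:R + 1) * s%:R / 2 :> R.
Proof.
have := mul_bin_diag s.+1 1; rewrite /= bin1 => /(congr1 (fun x => x%:R : R)).
by rewrite !natrM -natr1; lra.
Qed.

Lemma bin3R s : 'C(s.+2, 3)%:R = (s%:R + 2) * (s%:R + 1) * s%:R / 6 :> R.
Proof.
have := mul_bin_diag s.+2 2; rewrite /= => /(congr1 (fun x => x%:R : R)).
rewrite !natrM bin2R -(natr1 s.+1) -(natr1 s); lra.
Qed.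

Let zpow_le k x : p * q <= x -> (p * q) ^+ (2 + k) <= p ^+ 2 * x ^+ k.
Proof.
move=> zx; have z0 : 0 <= x by apply: le_trans zx.
rewrite exprD ler_pM ?exprn_ge0 // lerXn2r ?nnegrE //.
by rewrite ler_piMr.
Qed.

Let G_base b x k : 0 <= b -> p * q <= x -> b * x ^+ k <= 69 / 100 * T ^+ 2 ->
  b * (p * q) ^+ (2 + k) <= 69 / 100 * (T * p) ^+ 2.
Proof.
move=> b0 zx h; apply: (le_trans (ler_wpM2l b0 (zpow_le k zx))).
have := ler_wpM2l (exprn_ge0 2 p_ge0) h; rewrite exprMn; lra.
Qed.

Let G20 : G 2 0 <= 69 / 100 * (T * p) ^+ 2.
Proof.
rewrite /G muln0 !addn0 bin0 mulr1 (_ : t + 2 = t.+2)%N ?addn2 // bin2R -(natr1 t).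
apply: (@G_base _ _ 0 _ (lexx _)).
  by rewrite divr_ge0 ?mulr_ge0 ?addr_ge0.
have := ler_wpM2r (ler0n R t) T200; have := T200; rewrite expr0 expr2; lra.
Qed.

Let z0 := 2 * (T + 1) / (T + 3) ^+ 2.

(** Here and in [G12] the constant 69/100 arises: at the right end both terms are asymptotically 2/3
    of (t p)^2, and 207/200 absorbs the lower-order terms for t >= 200. *)
Let G21 : G 2 1 <= 69 / 100 * (T * p) ^+ 2.
Proof.
rewrite /G muln1 bin1 (_ : t + 2 + 2 = t.+4)%N; last by clear; lia.
rewrite bin3R -(natr1 t.+3) -(natr1 t.+2) -(natr1 t.+1) -(natr1 t).
have S200 := T200; have T3 : 0 < T + 3 by lra.
apply: (@G_base _ z0 2 _ pq_le); first by rewrite !(mulr_ge0, divr_ge0) //; lra.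
set S := T in S200 T3 *.
have -> : (S + 1 + 1 + 2) * (S + 1 + 1 + 1) * (S + 1 + 1) / 6 * (S + 1 + 1 + 1 + 1) * z0 ^+ 2
  = 2 / 3 * ((S + 4) * (S + 2)) * ((S + 4) * (S + 1) ^+ 2) / (S + 3) ^+ 3.
  by rewrite /z0; field; rewrite gt_eqF.
rewrite ler_pdivrMr ?exprn_gt0 //.
have h1 : (S + 4) * (S + 2) <= (S + 3) ^+ 2 by rewrite expr2; lra.
have s2 : 200 * S ^+ 2 <= S ^+ 3 by rewrite (exprS S 2) ler_wpM2r ?exprn_ge0 //; lra.
have s1 : 200 * S <= S ^+ 2 by rewrite expr2 ler_wpM2r //; lra.
have h2 : (S + 4) * (S + 1) ^+ 2 <= 207 / 200 * (S ^+ 2 * (S + 3)).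
  by rewrite -subr_ge0; lra.
have h3 : (S + 4) * (S + 2) * ((S + 4) * (S + 1) ^+ 2) <=
          (S + 3) ^+ 2 * (207 / 200 * (S ^+ 2 * (S + 3))).
  by apply: ler_pM; rewrite ?mulr_ge0 ?exprn_ge0 //; lra.
by rewrite -subr_ge0; move: h3; rewrite -subr_ge0; lra.
Qed.

Let G12 : G 1 2 <= 69 / 100 * (T * p) ^+ 2.
Proof.
rewrite /G (_ : t + 1 + 2 * 2 = t.+4.+1)%N; last by clear; lia.
rewrite bin3R bin2R -(natr1 t.+3) -(natr1 t.+2) -(natr1 t.+1) -(natr1 t).
have S200 := T200; have T3 : 0 < T + 3 by lra.
apply: (@G_base _ z0 3 _ pq_le); first by rewrite !(mulr_ge0, divr_ge0) //; lra.
set S := T in S200 T3 *.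
set lhs := (X in X <= _).
have -> : lhs = 2 / 3 * ((S + 5) * (S + 1)) ^+ 2 * ((S + 4) ^+ 2 * (S + 1)) / (S + 3) ^+ 5.
  by rewrite /lhs /z0; field; rewrite gt_eqF.
rewrite ler_pdivrMr ?exprn_gt0 //.
have h1 : ((S + 5) * (S + 1)) ^+ 2 <= ((S + 3) ^+ 2) ^+ 2.
  have a0 : 0 <= (S + 5) * (S + 1) by rewrite mulr_ge0 //; lra.
  have ab : (S + 5) * (S + 1) <= (S + 3) ^+ 2 by rewrite expr2; lra.
  by rewrite lerXn2r ?nnegrE ?(le_trans a0).
have s2 : 200 * S ^+ 2 <= S ^+ 3 by rewrite (exprS S 2) ler_wpM2r ?exprn_ge0 //; lra.
have s1 : 200 * S <= S ^+ 2 by rewrite expr2 ler_wpM2r //; lra.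
have h2 : (S + 4) ^+ 2 * (S + 1) <= 207 / 200 * (S ^+ 2 * (S + 3)).
  by rewrite -subr_ge0; lra.
have h3 : ((S + 5) * (S + 1)) ^+ 2 * ((S + 4) ^+ 2 * (S + 1)) <=
          ((S + 3) ^+ 2) ^+ 2 * (207 / 200 * (S ^+ 2 * (S + 3))).
  by apply: ler_pM => //; rewrite !(mulr_ge0, exprn_ge0) //; lra.
by rewrite -subr_ge0; move: h3; rewrite -subr_ge0; lra.
Qed.

Let G03 : G 0 3 <= 69 / 100 * (T * p) ^+ 2.
Proof.
rewrite /G (_ : t + 0 + 2 * 3 = t.+4.+2)%N; last by clear; lia.
rewrite bin3R -(natr1 t.+3) -(natr1 t.+2) -(natr1 t.+1) -(natr1 t).
have S200 := T200; have T3 : 0 < T + 3 by lra.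
have z2 : p * q <= 2 / (T + 3) by rewrite ler_pdivlMr.
apply: (@G_base _ _ 4 _ z2); first by rewrite !(mulr_ge0, divr_ge0) //; lra.
set S := T in S200 T3 *.
set lhs := (X in X <= _).
have -> : lhs = 4 / 9 * ((S + 6) * (S + 5) * (S + 4)) ^+ 2 / ((S + 3) ^+ 2) ^+ 2.
  by rewrite /lhs; field; rewrite gt_eqF.
rewrite ler_pdivrMr ?exprn_gt0 //.
have s2 : 200 * S ^+ 2 <= S ^+ 3 by rewrite (exprS S 2) ler_wpM2r ?exprn_ge0 //; lra.
have s1 : 200 * S <= S ^+ 2 by rewrite expr2 ler_wpM2r //; lra.
have h1 : (S + 6) * (S + 5) * (S + 4) <= 6 / 5 * (S * (S + 3) ^+ 2).
  by rewrite -subr_ge0; lra.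
have h2 : ((S + 6) * (S + 5) * (S + 4)) ^+ 2 <= (6 / 5 * (S * (S + 3) ^+ 2)) ^+ 2.
  have a0 : 0 <= (S + 6) * (S + 5) * (S + 4) by rewrite !mulr_ge0 //; lra.
  by rewrite lerXn2r ?nnegrE ?(le_trans a0).
have h3 : 0 <= (S * (S + 3) ^+ 2) ^+ 2 by rewrite !exprn_ge0 // mulr_ge0 ?exprn_ge0 //; lra.
by rewrite -subr_ge0; move: h2; rewrite -subr_ge0; lra.
Qed.

(** Outside the five near pairs everything descends to a corner (2, 0), (2, 1), (1, 2) or (0, 3):
    [a] is lowered first, then, when j >= 3, [j] along a = 0. *)
Lemma G_bound a j : ~~ [&& (j <= 2)%N, (a <= 1)%N & (a + j <= 2)%N] ->
  'C(t + a + 2 * j, a + j)%:R * 'C(t + a + 2 * j, j)%:R * (p * q) ^+ (a + 2 * j)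
  <= 69 / 100 * (T * p) ^+ 2.
Proof.
rewrite -/(G a j).
have up a0 : (2 <= a0 + j)%N -> G a0 j <= 69 / 100 * (T * p) ^+ 2 ->
    (a0 <= a)%N -> G a j <= 69 / 100 * (T * p) ^+ 2.
  move=> h0 h1 /subnKC <-; elim: (a - a0)%N => [|d IH]; first by rewrite addn0.
  by rewrite addnS; apply: le_trans IH; apply: G_step_a; rewrite addnAC ltn_addr.
move=> far; have [j3|j2] := leqP 3 j.
  apply: (up 0%N) => //; first exact: ltnW.
  rewrite -(subnKC j3); elim: (j - 3)%N => [|d IH]; first exact: G03.
  by rewrite addnS; apply: le_trans IH; apply: G_step_j; rewrite leq_addr.
case: j j2 far up => [|[|[|j]]] // _ far up.
- by apply: (up 2%N); [|exact: G20|move: far; clear; lia].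
- by apply: (up 2%N); [|exact: G21|move: far; clear; lia].
- by apply: (up 1%N); [|exact: G12|move: far; clear; lia].
Qed.

Let tail_ge s i : 'C(s, i)%:R * p ^+ (s - i) * q ^+ i <= tail p s i.
Proof.
case: i => [|i]; first by rewrite tail0 bin0 subn0 expr0 mul1r mulr1.
by rewrite tailS lerDr mu_ge0 // p_ge0 /=; move: q_ge0; rewrite subr_ge0.
Qed.

(** * Numerical conditions for the near cases, and comparison of the candidates *)

(** One term of [tail] suffices, leaving p <= 4/5 C(s, i) p^i q^m with m <= 2t + 7, the largest
    exponent occurring for i = 0 and j = 2. The tightest case is i = 0, which holds because p <=
    1/100, q^m >= 1/61 and 61/100 < 4/5. *)
Lemma near_num i j : (i <= 2)%N -> (j <= 2)%N ->
  p ^+ (t + j - i).+1 <= 4 / 5 * tail p (t + i + j) i * q ^+ (2 * (t + j - i) + 3).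
Proof.
move=> i2 j2; set L := (t + j - i)%N; set s := (t + i + j)%N.
have le := tail_ge s i.
have k45 : 0 <= 4 / 5 :> R by lra.
have qL : 0 <= q ^+ (2 * L + 3) by rewrite exprn_ge0.
apply: le_trans (ler_wpM2r qL (ler_wpM2l k45 le)).
have -> : (s - i = t + j)%N by rewrite /s; clear; lia.
have tj : (t + j = L + i)%N by move: t200 i2; rewrite /L; clear; lia.
have q61 m : (m <= 2 * t + 7)%N -> 1 / 61 <= q ^+ m by apply: q_pow61.
rewrite exprS tj exprD.
have -> : 4 / 5 * ('C(s, i)%:R * (p ^+ L * p ^+ i) * q ^+ i) * q ^+ (2 * L + 3) =
  4 / 5 * ('C(s, i)%:R * p ^+ i) * q ^+ (2 * L + 3 + i) * p ^+ L.
  by rewrite [q ^+ (_ + i)]exprD; ring.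
rewrite ler_wpM2r ?exprn_ge0 //.
have := q61 (2 * L + 3 + i)%N; move: {le qL q61} (q ^+ _) => Q.
have -> : (2 * L + 3 + i <= 2 * t + 7)%N by move: i2 j2 t200; rewrite /L; clear; lia.
move=> /(_ isT) Qge.
have S200 := T200; have ps := p_small; have p0 := p_ge0.
case: i @L @s i2 tj => [|[|[|i]]] // L s _ tj.
- by rewrite bin0 expr0; lra.
- rewrite bin1 expr1.
  have Ts : T + 1 <= s%:R by rewrite natr1 ler_nat /s; clear; lia.
  have h1 : p * (T + 1) <= p * s%:R by rewrite ler_wpM2l.
  have h2 : p * 201 <= p * (T + 1) by rewrite ler_wpM2l //; lra.
  have h3 : p * s%:R * (1 / 61) <= p * s%:R * Q by rewrite ler_wpM2l // mulr_ge0.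
  lra.
have sE : s = (t + 1 + j).+1 by rewrite /s; clear; lia.
have Ts : T + 1 <= (t + 1 + j)%:R by rewrite natr1 ler_nat; clear; lia.
rewrite sE bin2R.
set S := (t + 1 + j)%:R in Ts *.
have h1 : 1 <= p * S by apply: (le_trans p_ge); rewrite ler_wpM2l.
have h2 : p * 1 * (S + 1) <= p * (p * S) * (S + 1).
  by rewrite ler_wpM2r ?ler_wpM2l //; lra.
have h4 : p * 202 <= p * (S + 1) by rewrite ler_wpM2l //; lra.
have h0 : 0 <= p * (p * S) * (S + 1) by rewrite !mulr_ge0 //; lra.
have h3 := ler_wpM2l h0 Qge.
have -> : 4 / 5 * ((S + 1) * S / 2 * p ^+ 2) * Q = 2 / 5 * (p * (p * S) * (S + 1) * Q)
  by rewrite expr2; field.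
lra.
Qed.

Lemma near_early i j : (i <= 2)%N -> (j <= 2)%N ->
  9 / 10 * tail p (t + i + j) i <= 'C(t, i)%:R * p ^+ (t + j) * q ^+ i.
Proof.
move=> i2 j2; set s := (t + i + j)%N.
have S200 := T200; have ps := p_small; have p0 := p_ge0.
have J2 : j%:R <= 2 :> R by rewrite (ler_nat R j 2).
have pj : 0 <= p ^+ (t + j) by rewrite exprn_ge0.
have q9 : 99 / 100 <= q by rewrite /q; lra.
case: i @s i2 => [|[|[|i]]] // s _.
- by rewrite tail0 bin0 expr0 /s addn0 mul1r mulr1; lra.
- rewrite tailS tail0 !bin1 !expr1.
  have -> : (s - 1 = t + j)%N by rewrite /s; clear; lia.
  have -> : s = (t + j).+1 by rewrite /s; clear; lia.
  rewrite exprSr -(natr1 (t + j)) natrD.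
  have h : 0 <= T * q - 9 / 10 * (p + (T + j%:R + 1) * q).
    have q1 := q_le1; have hq : 17 * (99 / 100) <= (T / 10 - 27 / 10) * q.
      by apply: ler_pM => //; lra.
    have hj : (j%:R) * q <= 2 * q by rewrite ler_wpM2r.
    lra.
  by have := mulr_ge0 pj h; rewrite -/q; lra.
rewrite tailS tailS tail0 !bin1 !expr1.
have sE : s = (t + j).+2 by rewrite /s; clear; lia.
have -> : (s - 2 = t + j)%N by rewrite sE; clear; lia.
have -> : (s - 1 = (t + j).+1)%N by rewrite sE; clear; lia.
have [t' tE] : exists t', t = t'.+1 by exists t.-1; move: t200; clear; lia.
rewrite sE !exprSr bin2R -(natr1 (t + j).+1) -(natr1 (t + j)) natrD.
have -> : 'C(t, 2)%:R = T * (T - 1) / 2 :> R by rewrite tE bin2R -(natr1 t'); field.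
set J := j%:R in J2 *; set S := T in S200 *; set P := p ^+ (t + j) in pj *.
have J0 : 0 <= J by rewrite ler0n.
have h : 0 <= S * (S - 1) / 2 * q ^+ 2 -
     9 / 10 * (p * p + (S + J + 2) * (p * q) + (S + J + 2) * (S + J + 1) / 2 * q ^+ 2).
  have b1 : (S + J + 2) * (p * q) <= 5.
    apply: (@le_trans _ _ ((S + J + 2) * p * 1)).
      by rewrite mulrA ler_wpM2l ?q_le1 // mulr_ge0 //; lra.
    have : p * J <= p * 2 by rewrite ler_wpM2l.
    by move: p_le; rewrite -/S; lra.
  have pp : p * p <= 1 * 1 by rewrite ler_pM //; lra.
  have b2 : (S + J + 2) * (S + J + 1) <= (S + 4) * (S + 3) by apply: ler_pM => //; lra.
  have ss : 200 * S <= S * S by rewrite ler_wpM2r //; lra.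
  have b3 : 2000 <= S * (S - 1) - 9 / 10 * ((S + J + 2) * (S + J + 1)) by lra.
  have q2 : 9 / 10 <= q ^+ 2.
    apply: (@le_trans _ _ ((99 / 100) * (99 / 100))); first lra.
    by rewrite expr2 ler_pM //; lra.
  have b4 : 2000 * (9 / 10) <= (S * (S - 1) - 9 / 10 * ((S + J + 2) * (S + J + 1))) * q ^+ 2.
    by rewrite ler_pM //; lra.
  lra.
have := mulr_ge0 pj h; rewrite -/q; lra.
Qed.

(** The differences factor: [f1] minus the weight is a positive multiple of p (t+1) - 1 for r = 0
    and of 2 - p (t+3) for r = 2. *)
Lemma tail_diag r : (r <= 2)%N -> tail p (t + 2 * r) r <= f1 /\
  (tail p (t + 2 * r) r = f1 <->
   [\/ r = 0%N /\ p * (T + 1) = 1, r = 1%N | r = 2%N /\ p * (T + 3) = 2]).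
Proof.
have pt : 0 < p ^+ t by rewrite exprn_gt0.
case: r => [|[|[|r]]] // _.
- rewrite muln0 addn0 tail0.
  have e : f1 - p ^+ t = p ^+ t * q * (p * (T + 1) - 1) by rewrite f1E /q; ring.
  have pq0 : 0 < p ^+ t * q by rewrite mulr_gt0.
  split; first by rewrite -subr_ge0 e pmulr_rge0 // subr_ge0.
  split=> [h|[[_ h]|//|[//]]].
    apply: Or31; split=> //; apply/eqP; rewrite -subr_eq0.
    have d0 : f1 - p ^+ t = 0 by rewrite h subrr.
    by move/eqP: e; rewrite d0 eq_sym mulf_eq0 (gt_eqF pq0).
  by apply/eqP; rewrite eq_sym -subr_eq0 e h subrr mulr0.
- have -> : tail p (t + 2 * 1) 1 = f1.
    rewrite muln1 tailS tail0 bin1 expr1 (_ : t + 2 - 1 = t + 1)%N; last by clear; lia.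
    by rewrite /f1 natrD -/q; ring.
  by split=> //; split=> // _; apply: Or32.
rewrite muln2 -[(2.*2)%N]/4%N.
have e : f1 - tail p (t + 4) 2 = p ^+ t * (p * (T + 2) * q ^+ 2 / 2) * (2 - p * (T + 3)).
  rewrite !tailS tail0 bin1 expr1 (_ : t + 4 - 1 = t + 3)%N; last by clear; lia.
  rewrite (_ : t + 4 - 2 = t + 2)%N; last by clear; lia.
  have -> : 'C(t + 4, 2)%:R = (T + 3 + 1) * (T + 3) / 2 :> R by rewrite addnS bin2R natrD.
  by rewrite f1E natrD !exprD /q; field.
have h0 : 0 < p ^+ t * (p * (T + 2) * q ^+ 2 / 2).
  by rewrite mulr_gt0 // divr_gt0 // !mulr_gt0 ?exprn_gt0 //; move: T200; lra.
split; first by rewrite -subr_ge0 e pmulr_rge0 // subr_ge0.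
split=> [h|[[//]|//|[_ h]]].
  apply: Or33; split=> //; apply/eqP; rewrite eq_sym -subr_eq0.
  by move/eqP: e; rewrite h subrr eq_sym mulf_eq0 (gt_eqF h0).
by apply/eqP; rewrite eq_sym -subr_eq0 e h subrr mulr0.
Qed.

Lemma tail_off_diag j : (j <= 1)%N ->
  tail p (t + j.+1 + j) j.+1 * tail p (t + j.+1 + j) j < f1 ^+ 2.
Proof.
have S200 := T200; have ps := p_small; have p0 := p_gt0; have phi := phi_ge1.
have ptt : 0 < p ^+ t * p ^+ t by rewrite mulr_gt0 ?exprn_gt0.
case: j => [|[|j]] // _.
  rewrite addn0 tailS tail0 bin1 expr1 (_ : t + 1 - 1 = t)%N; last by clear; lia.
  have -> : (p ^+ (t + 1) + (t + 1)%:R * p ^+ t * (1 - p)) * p ^+ (t + 1) =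
     p ^+ t * p ^+ t * (p * ((T + 1) * q + p)).
    by rewrite exprD natrD /q expr1; ring.
  rewrite f1E exprMn [(p ^+ t) ^+ 2]expr2 ltr_pM2l //.
  set x := p * ((T + 2) * q + p) in phi *.
  have h : p * ((T + 1) * q + p) < x.
    by rewrite /x ltr_pM2l // ltrD2r ltr_pM2r // ltrD2l; lra.
  by apply: (lt_le_trans h); rewrite expr2 ler_peMr // (le_trans ler01).
rewrite (_ : t + 2 + 1 = t + 3)%N; last by clear; lia.
rewrite !tailS tail0 bin1 expr1 (_ : t + 3 - 1 = t + 2)%N; last by clear; lia.
rewrite (_ : t + 3 - 2 = t + 1)%N; last by clear; lia.
have -> : 'C(t + 3, 2)%:R = (T + 2 + 1) * (T + 2) / 2 :> R by rewrite addnS bin2R natrD.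
set X := (T + 2) * q + p in phi.
have X0 : 198 <= X by rewrite /X /q; have := p_le; lra.
set Bk := (T + 3) * (T + 2) / 2 * q ^+ 2 + (T + 3) * p * q + p ^+ 2.
set lhs := (X in X < _).
have -> : lhs = p ^+ t * p ^+ t * (p ^+ 2 * (p * Bk * (X + q))).
  by rewrite /lhs /X /Bk natrD !exprD /q; field.
rewrite f1E exprMn [(p ^+ t) ^+ 2]expr2 ltr_pM2l // -/X exprMn ltr_pM2l ?exprn_gt0 //.
have q1 := q_le1; have q0 := q_gt0.
have hB : p * Bk <= q * X + p * (q + p ^+ 2).
  have h1 : p * (T + 3) * ((T + 2) / 2 * q ^+ 2) <= 2 * ((T + 2) / 2 * q ^+ 2).
    by rewrite ler_wpM2r // mulr_ge0 ?exprn_ge0 ?q_ge0 //; lra.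
  have h2 : p * (T + 3) * (p * q) <= 2 * (p * q) by rewrite ler_wpM2r // mulr_ge0 // ltW.
  rewrite /Bk /X; rewrite !expr2 in h1 h2 *; lra.
have Xq : 0 <= X + q by lra.
by apply: (le_lt_trans (ler_wpM2r Xq hB)); apply: off_diag_poly.
Qed.
End Estimates.

(** * The bound for walks *)

Lemma hit0 w : hit 0 w. Proof. by case: w. Qed.

Lemma count_not_hit u w k : (k <= size w)%N -> ~~ hit u.+1 w ->
  (2 * count id (take k w) <= k + u)%N.
Proof.
move=> kw; apply: contraNleq => h; apply/hitP; exists k => //.
by rewrite addnS.
Qed.

Lemma exists_level n (A : pred (seq bool)) X0 : size X0 = n -> A X0 ->
  exists u, (forall X, size X = n -> A X -> hit u X) /\
            exists X, [/\ size X = n, A X & ~~ hit u.+1 X].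
Proof.
move=> s0 A0.
pose P m := `[< exists X, [/\ size X = n, A X & ~~ hit m X] >].
(* A walk of [n] steps never reaches level n + 1, so some level is missed; u is the predecessor of
   the least missed one. *)
have ex : exists m, P m.
  exists n.+1; apply/asboolP; exists X0; split=> //; apply/hitP => -[s].
  have := count_take_le s X0; rewrite s0; clear; lia.
case: (ex_minnP ex) => -[|u] /asboolP Pu min.
  by case: Pu => X []; rewrite hit0.
exists u; split=> // X sX AX; apply/negPn/negP => nh.
have /min : P u by apply/asboolP; exists X.
by rewrite ltnn.
Qed.

Section WalkTheorem.
Variables (R : realType) (t : nat) (p : R).
Hypothesis t200 : (200 <= t)%N.
Hypothesis p_ge : 1 <= p * (t%:R + 1).
Hypothesis p_le : p * (t%:R + 3) <= 2.
Let q : R := 1 - p.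
Let al : R := p / q.
Local Notation T := (t%:R : R).
Let f1 : R := (T + 2) * p ^+ (t + 1) * q + p ^+ (t + 2).

Let T200 : 200 <= T. Proof. by rewrite (ler_nat R 200). Qed.
Let p_gt0 : 0 < p.
Proof.
have T1 : 0 < T + 1 by have := T200; lra.
by rewrite -(pmulr_lgt0 _ T1); apply: lt_le_trans p_ge.
Qed.
Let p_small : p <= 1 / 100.
Proof. have := ler_wpM2l (ltW p_gt0) T200; move: p_le; lra. Qed.
Let p_lt1 : p < 1. Proof. by move: p_small; lra. Qed.
Let q_gt0 : 0 < q. Proof. by move: p_small; rewrite /q; lra. Qed.
Let p_ge0 : 0 <= p. Proof. exact: ltW. Qed.
Let q_ge0 : 0 <= q. Proof. exact: ltW. Qed.
Let p01 : 0 <= p <= 1. Proof. by rewrite p_ge0 ltW. Qed.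
Let al_gt0 : 0 < al. Proof. exact: divr_gt0. Qed.
Let al_le : al <= 1 / 99.
Proof. by rewrite ler_pdivrMr //; move: p_small; rewrite /q; lra. Qed.
Let f1_gt0 : 0 < f1.
Proof.
rewrite /f1 ltr_wpDl ?exprn_gt0 // !mulr_ge0 ?exprn_ge0 //.
by move: T200; lra.
Qed.
Let crude : 69 / 10 * al ^+ (2 * t + 1) <= f1 ^+ 2.
Proof. exact: crude_bound. Qed.
Let f2_gt0 : 0 < f1 ^+ 2. Proof. exact: exprn_gt0. Qed.
Let al2_gt0 : 0 < al ^+ (2 * t + 1). Proof. exact: exprn_gt0. Qed.
Let f1_sqr_ge : p ^+ (2 * t) * (T * p) ^+ 2 <= f1 ^+ 2.
Proof. exact: f1_sqr_ge. Qed.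

Definition extremal n r (A : pred (seq bool)) :=
  forall w, size w = n -> A w = tall (t + 2 * r) r w.

Definition critical r :=
  [\/ r = 0%N /\ p * (t%:R + 1) = 1, r = 1%N | r = 2%N /\ p * (t%:R + 3) = 2].

Let mu_le_hit n u (A : pred (seq bool)) :
  (forall X, size X = n -> A X -> hit u X) -> mu p n A <= al ^+ u.
Proof. by move=> h; apply: le_trans (mu_hit p_gt0 p_lt1 n u); apply: mu_le. Qed.

Let near_case n a j (A B : pred (seq bool)) :
  (j <= 2)%N -> (a <= 1)%N -> (a + j <= 2)%N -> walk_cross t n A B ->
  (t + (a + j) + j <= n)%N ->
  (forall X, size X = n -> A X -> hit (t + j - (a + j)).+1 X || tall (t + (a + j) + j) (a + j)
    X) ->
  (forall Y, size Y = n -> B Y -> hit (t + (a + j) - j).+1 Y || tall (t + (a + j) + j) j Y) ->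
  mu p n A * mu p n B <= f1 ^+ 2 /\
  (mu p n A * mu p n B = f1 ^+ 2 ->
    exists r, [/\ (t + 2 * r <= n)%N, critical r, extremal n r A & extremal n r B]).
Proof.
move=> j2 a1 aj cross sn hA hB.
have pq : p <= q by rewrite /q; move: p_small; lra.
have jt : (j <= t)%N by move: t200 j2; clear; lia.
have ajt : (a + j <= t)%N by move: t200 aj; clear; lia.
have nA := near_num t200 p_ge p_le aj j2.
have := near_num t200 p_ge p_le j2 aj; rewrite (addnAC t j) => nB.
have eA := near_early t200 p_ge p_le aj j2.
have := near_early t200 p_ge p_le j2 aj; rewrite (addnAC t j) => eB.
have [le eq] := near_extremal p_gt0 p_lt1 pq sn ajt jt cross hA hB nA nB eA eB.
case: a a1 aj sn hA hB ajt nA nB eA eB le eq => [|[|a]] // _ aj sn _ _ _ _ _ _ _ le eq.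
  have tE : (t + (0 + j) + j = t + 2 * j)%N by clear; lia.
  rewrite tE add0n in sn le eq.
  have [tl te] := tail_diag t200 p_ge p_le j2.
  rewrite -/q -/f1 in tl te.
  have t0 : 0 <= tail p (t + 2 * j) j by rewrite mu_ge0.
  have tt : tail p (t + 2 * j) j * tail p (t + 2 * j) j <= f1 ^+ 2.
    by rewrite expr2 ler_pM.
  split; first exact: le_trans tt.
  move=> e; rewrite e in le.
  have e2 : tail p (t + 2 * j) j * tail p (t + 2 * j) j = f1 ^+ 2.
    by apply/le_anti; rewrite tt le.
  have /te crit : tail p (t + 2 * j) j = f1.
    by apply/eqP; rewrite -(@eqrXn2 _ 2) ?(ltW f1_gt0) // expr2 e2.
  by exists j; split=> // w sw; have [] := eq (etrans e (esym e2)) w sw.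
have lt := tail_off_diag t200 p_ge p_le aj.
rewrite add1n in le; have {}lt := le_lt_trans le lt.
by split; [exact: ltW | move=> e; rewrite -/q -/f1 -e ltxx in lt].
Qed.

(** Each family splits into walks pinned at time s and walks reaching one level more. Pinned pairs
    are covered by [G_bound]; the other three products carry a spare factor al. *)
Let far_case n a j (A B : pred (seq bool)) :
  ~~ [&& (j <= 2)%N, (a <= 1)%N & (a + j <= 2)%N] -> (a <= t)%N ->
  (t + a + 2 * j <= n)%N ->
  (forall X, size X = n -> A X -> hit (t - a) X) ->
  (forall Y, size Y = n -> B Y -> hit (t + a) Y) ->
  (forall X, size X = n -> A X -> ~~ hit (t - a).+1 X ->
     (count id (take (t + a + 2 * j) X) + (a + j))%N = (t + a + 2 * j)%N) ->
  (forall Y, size Y = n -> B Y -> ~~ hit (t + a).+1 Y ->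
     (count id (take (t + a + 2 * j) Y) + j)%N = (t + a + 2 * j)%N) ->
  mu p n A * mu p n B < f1 ^+ 2.
Proof.
move=> far a_t sn Ahit Bhit As Bs; set s := (t + a + 2 * j)%N in sn As Bs.
have part u k (C : pred (seq bool)) : (forall X, size X = n -> C X -> hit u X) ->
    (forall X, size X = n -> C X -> ~~ hit u.+1 X -> (count id (take s X) + k)%N = s) ->
    exists x, [/\ 0 <= x, x <= al ^+ u, x <= 'C(s, k)%:R * p ^+ (s - k) * q ^+ k &
      mu p n C <= x + al ^+ u.+1].
  move=> Chit Cs; exists (mu p n (fun w => C w && ~~ hit u.+1 w)); split.
  - exact: mu_ge0.
  - by apply: mu_le_hit => X sX /andP[CX _]; apply: Chit.
  - rewrite -mu_count -(mu_take _ _ sn); apply: mu_le => // X sX /andP[CX nX].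
    by rewrite (Cs X sX CX nX).
  rewrite (mu_split _ _ _ (fun w => ~~ hit u.+1 w)) lerD2l.
  by apply: mu_le_hit => X sX /andP[_ /negPn].
have [x [x0 xu xs Ax]] := part _ _ _ Ahit As.
have [y [y0 yv ys By]] := part _ _ _ Bhit Bs.
have alu : al ^+ (t - a) * al ^+ (t + a) * al = al ^+ (2 * t + 1).
  by rewrite -exprD -exprSr; congr (_ ^+ _); move: a_t; clear; lia.
have U0 : 0 < al ^+ (t - a) by rewrite exprn_gt0.
have V0 : 0 < al ^+ (t + a) by rewrite exprn_gt0.
have xy : x * y <= 69 / 100 * f1 ^+ 2.
  have := G_bound t200 p_ge p_le far; rewrite -/q -/s => G.
  apply: (le_trans (ler_pM x0 y0 xs ys)).
  have -> : (s - (a + j) = t + j)%N by rewrite /s; clear; lia.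
  have -> : (s - j = t + a + j)%N by rewrite /s; clear; lia.
  set X := _%:R in G *; set Y := _%:R in G *.
  have -> : X * p ^+ (t + j) * q ^+ (a + j) * (Y * p ^+ (t + a + j) * q ^+ j) =
     X * Y * (p * q) ^+ (a + 2 * j) * p ^+ (2 * t).
    have -> : (a + 2 * j = a + j + j)%N by clear; lia.
    have -> : (2 * t = t + t)%N by clear; lia.
    by rewrite exprMn !exprD; ring.
  have pt : 0 <= p ^+ (2 * t) by rewrite exprn_ge0.
  apply: (le_trans (ler_wpM2r pt G)); move: f1_sqr_ge; rewrite mulrC; lra.
apply: (le_lt_trans (ler_pM (mu_ge0 _ _ p01) (mu_ge0 _ _ p01) Ax By)).
move: alu U0 V0 xu yv; rewrite (exprS al (t - a)) (exprS al (t + a)).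
set U := al ^+ (t - a); set V := al ^+ (t + a) => alu U0 V0 xu yv.
have h1 : x * (al * V) <= U * (al * V) by rewrite ler_wpM2r // mulr_ge0 // ltW.
have h2 : al * U * y <= al * U * V by rewrite ler_wpM2l // mulr_ge0 // ltW.
have h3 : al * (U * V * al) <= 1 / 99 * (U * V * al) by rewrite ler_wpM2r // alu ltW.
have := crude; have := f2_gt0; rewrite -alu.
have -> : (x + al * U) * (y + al * V) =
  x * y + x * (al * V) + al * U * y + al * (U * V * al) by ring.
move: xy h1 h2 h3; set F := f1 ^+ 2; set z := U * V * al.
have -> : U * (al * V) = z by rewrite /z; ring.
have -> : al * U * V = z by rewrite /z; ring.
lra.
Qed.

Let walk_core n u v (A B : pred (seq bool)) : (u <= v)%N -> walk_cross t n A B ->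
  (forall X, size X = n -> A X -> hit u X) ->
  (forall Y, size Y = n -> B Y -> hit v Y) ->
  (exists X, [/\ size X = n, A X & ~~ hit u.+1 X]) ->
  (exists Y, [/\ size Y = n, B Y & ~~ hit v.+1 Y]) ->
  mu p n A * mu p n B <= f1 ^+ 2 /\
  (mu p n A * mu p n B = f1 ^+ 2 ->
    exists r, [/\ (t + 2 * r <= n)%N, critical r, extremal n r A & extremal n r B]).
Proof.
move=> uv cross Ahit Bhit [X0 [sX0 AX0 nX0]] [Y0 [sY0 BY0 nY0]].
have strict : mu p n A * mu p n B < f1 ^+ 2 -> mu p n A * mu p n B <= f1 ^+ 2 /\
  (mu p n A * mu p n B = f1 ^+ 2 ->
    exists r, [/\ (t + 2 * r <= n)%N, critical r, extremal n r A & extremal n r B]).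
  by move=> lt; split; [exact: ltW | move=> e; rewrite e ltxx in lt].
(* Heights adding up to at least 2t cannot exceed u + v; if u + v = 2t, both walks are at their
   maximum at one common time. *)
have top X Y : size X = n -> size Y = n -> A X -> B Y -> ~~ hit u.+1 X -> ~~ hit v.+1 Y ->
  exists k, [/\ (k <= n)%N, (2 * t <= u + v)%N &
    (u + v = 2 * t)%N -> (k + u = 2 * count id (take k X))%N /\
      (k + v = 2 * count id (take k Y))%N].
  move=> sX sY AX BY nX nY; have [k kn h] := cross X Y sX sY AX BY.
  have := @count_not_hit u X k; have := @count_not_hit v Y k.
  rewrite sX sY => /(_ kn nY) h1 /(_ kn nX) h2; exists k; split=> //.
    by move: h h1 h2; clear; lia.
  by move: h h1 h2; clear; lia.
have [_ [_ uv2 _]] := top _ _ sX0 sY0 AX0 BY0 nX0 nY0.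
have muA := mu_le_hit Ahit; have muB := mu_le_hit Bhit.
have prod_le c d : mu p n A <= c -> mu p n B <= d -> mu p n A * mu p n B <= c * d.
  by move=> *; apply: ler_pM => //; apply: mu_ge0.
have al1 : al <= 1 by move: al_le; lra.
have [lt|ge] := ltnP (2 * t) (u + v).
  apply: strict; apply: (le_lt_trans (prod_le _ _ muA muB)); rewrite -exprD.
  have : al ^+ (u + v) <= al ^+ (2 * t + 1).
    by rewrite ler_wiXn2l ?(ltW al_gt0) // addn1.
  by move: crude f2_gt0 al2_gt0; lra.
have uvE : (u + v = 2 * t)%N by apply/eqP; rewrite eqn_leq ge.
have alE : al ^+ u * al ^+ v * al = al ^+ (2 * t + 1) by rewrite -exprD -exprSr uvE addn1.
have p_al : p <= al by rewrite /al ler_pdivlMr // ler_piMr // /q; move: p_gt0; lra.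
have again w (C : pred (seq bool)) : (forall X, size X = n -> C X -> hit w X) ->
    (forall X, size X = n -> C X -> ~~ hit w.+1 X -> hit_again w X) ->
    mu p n C <= 2 * (al * al ^+ w).
  move=> Ch Ca; rewrite (mu_split _ _ _ (hit w.+1)).
  have h1 : mu p n (fun X => C X && hit w.+1 X) <= al ^+ w.+1.
    by apply: mu_le_hit => X _ /andP[].
  have h2 : mu p n (fun X => C X && ~~ hit w.+1 X) <= p * al ^+ w.
    apply: le_trans (mu_hit_again p_gt0 p_lt1 n w).
    by apply: mu_le => // X sX /andP[CX nX]; apply: Ca.
  have h3 : p * al ^+ w <= al * al ^+ w by rewrite ler_wpM2r // exprn_ge0 // ltW.
  by rewrite exprS in h1; lra.
have [exA|nexA] := pselect (exists X, [/\ size X = n, A X, ~~ hit u.+1 X & ~~ hit_again u X]);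
  last first.
  apply: strict; have h : mu p n A <= 2 * (al * al ^+ u).
    apply: again => // X sX AX nX; apply/negPn/negP => na; apply: nexA.
    by exists X.
  apply: (le_lt_trans (prod_le _ _ h muB)).
  have -> : 2 * (al * al ^+ u) * al ^+ v = 2 * al ^+ (2 * t + 1) by rewrite -alE; ring.
  by move: crude f2_gt0 al2_gt0; lra.
have [exB|nexB] := pselect (exists Y, [/\ size Y = n, B Y, ~~ hit v.+1 Y & ~~ hit_again v Y]);
  last first.
  apply: strict; have h : mu p n B <= 2 * (al * al ^+ v).
    apply: again => // X sX AX nX; apply/negPn/negP => na; apply: nexB.
    by exists X.
  apply: (le_lt_trans (prod_le _ _ muA h)).
  have -> : al ^+ u * (2 * (al * al ^+ v)) = 2 * al ^+ (2 * t + 1) by rewrite -alE; ring.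
  by move: crude f2_gt0 al2_gt0; lra.
have [X1 [sX1 AX1 nX1 naX1]] := exA; have [Y1 [sY1 BY1 nY1 naY1]] := exB.
have [s [sn _ /(_ uvE)[sX1u sY1v]]] := top _ _ sX1 sY1 AX1 BY1 nX1 nY1.
have once w k l X : size X = n -> (k <= n)%N -> (l <= n)%N -> ~~ hit w.+1 X -> ~~ hit_again w X ->
   (k + w = 2 * count id (take k X))%N -> (l + w = 2 * count id (take l X))%N -> k = l.
  move=> sX kn ln nX naX hk hl; apply/eqP; apply: contraNT naX; rewrite neq_ltn => /orP[kl|lk].
    by apply: (@hit_againP w X k l) => //; rewrite sX kl.
  by apply: (@hit_againP w X l k) => //; rewrite sX lk.
(* [Y1] is at level [v] only at time [s], so every walk of A with maximum [u] must meet it there. *)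
have As X : size X = n -> A X -> ~~ hit u.+1 X -> (s + u = 2 * count id (take s X))%N.
  move=> sX AX nX; have [k [kn _ /(_ uvE)[kX kY]]] := top _ _ sX sY1 AX BY1 nX nY1.
  by rewrite (once _ _ _ _ sY1 sn kn nY1 naY1 sY1v kY).
have Bs Y : size Y = n -> B Y -> ~~ hit v.+1 Y -> (s + v = 2 * count id (take s Y))%N.
  move=> sY BY nY; have [k [kn _ /(_ uvE)[kX kY]]] := top _ _ sX1 sY AX1 BY nX1 nY.
  by rewrite (once _ _ _ _ sX1 sn kn nX1 naX1 sX1u kX).
(* [j] counts the down-steps of [Y1] before [s], so s = v + 2j. *)
pose j := (s - count id (take s Y1))%N; pose a := (v - t)%N.
have cs := count_take_le s Y1.
have sE : (s = t + a + 2 * j)%N by move: uvE uv cs sY1v; rewrite /a /j; clear; lia.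
have uE : (u = t - a)%N by move: uvE uv; rewrite /a; clear; lia.
have vE : (v = t + a)%N by move: uvE uv; rewrite /a; clear; lia.
have a_t : (a <= t)%N by move: uvE uv; rewrite /a; clear; lia.
case near: ([&& (j <= 2)%N, (a <= 1)%N & (a + j <= 2)%N]).
  case/and3P: near => j2 a1 aj.
  have s' : (t + (a + j) + j = s)%N by rewrite sE; clear; lia.
  apply: (@near_case n a j) => //; first by rewrite s'.
  - move=> X sX AX; have -> : (t + j - (a + j) = u)%N by rewrite uE; move: a_t; clear; lia.
    case h: (hit u.+1 X) => //=; rewrite /tall s'.
    have := As X sX AX (negbT h); move: sE uE a_t; clear; lia.
  - move=> Y sY BY; have -> : (t + (a + j) - j = v)%N by rewrite vE; clear; lia.
    case h: (hit v.+1 Y) => //=; rewrite /tall s'.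
    have := Bs Y sY BY (negbT h); move: sE vE; clear; lia.
apply: strict; apply: (@far_case n a j) => //.
- by rewrite near.
- by rewrite -sE.
- by rewrite -uE.
- by rewrite -vE.
- rewrite -sE -uE => X sX AX nX; have := As X sX AX nX; move: sE uE a_t; clear; lia.
rewrite -sE -vE => Y sY BY nY; have := Bs Y sY BY nY; move: sE vE; clear; lia.
Qed.

Lemma walk_theorem n (A B : pred (seq bool)) : walk_cross t n A B ->
  mu p n A * mu p n B <= f1 ^+ 2 /\
  (mu p n A * mu p n B = f1 ^+ 2 ->
    exists r, [/\ (t + 2 * r <= n)%N, critical r, extremal n r A & extremal n r B]).
Proof.
move=> cross.
have zero : mu p n A * mu p n B = 0 -> mu p n A * mu p n B <= f1 ^+ 2 /\
  (mu p n A * mu p n B = f1 ^+ 2 ->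
    exists r, [/\ (t + 2 * r <= n)%N, critical r, extremal n r A & extremal n r B]).
  move=> ->; split; first exact: ltW.
  by move=> e; have := f2_gt0; rewrite -e ltxx.
have [[X [sX AX]]|nA] := pselect (exists X, size X = n /\ A X); last first.
  apply: zero; rewrite (@mu_pred0 _ _ _ A) ?mul0r // => w sw; apply/negP => Aw.
  by apply: nA; exists w.
have [[Y [sY BY]]|nB] := pselect (exists Y, size Y = n /\ B Y); last first.
  apply: zero; rewrite (@mu_pred0 _ _ _ B) ?mulr0 // => w sw; apply/negP => Bw.
  by apply: nB; exists w.
have [u [Ahit exA]] := exists_level sX AX; have [v [Bhit exB]] := exists_level sY BY.
have [uv|vu] := leqP u v; first exact: (@walk_core n u v).
have crossC : walk_cross t n B A.
  move=> Y' X' sY' sX' BY' AX'; have [k kn h] := cross _ _ sX' sY' AX' BY'.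
  by exists k => //; rewrite [leqRHS]addnC.
have [le eq] := walk_core (ltnW vu) crossC Bhit Ahit exB exA.
rewrite mulrC; split=> // /eq[r [tr cr eB eA]].
by exists r.
Qed.
End WalkTheorem.

(** * Words and sets *)

Section Words.
Variable n : nat.
Implicit Types (F : {set 'I_n}) (A : {set {set 'I_n}}).

Definition word F : n.-tuple bool := [tuple k \in F | k < n].
Definition wset (w : seq bool) : {set 'I_n} := [set k : 'I_n | nth false w k].

Lemma wordK F : wset (word F) = F.
Proof. by apply/setP => k; rewrite inE -tnth_nth tnth_mktuple. Qed.

Lemma wsetK w : size w = n -> word (wset w) = w :> seq bool.
Proof.
move=> sw; apply: (@eq_from_nth _ false); rewrite size_tuple ?sw // => k kn.
rewrite (nth_map (Ordinal kn)) ?size_enum_ord // inE.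
by congr (nth _ _ _); rewrite nth_enum_ord.
Qed.

Lemma count_take_word F s : count id (take s (word F)) = #|F :&: initseg n s|.
Proof.
have -> : val (word F) = map (mem F) (enum 'I_n) by [].
rewrite -map_take count_map.
have -> : #|F :&: initseg n s| = count [pred k | (k \in F) && (k < s)%N] (enum 'I_n).
  by rewrite cardE -size_filter enumT /enum_mem; congr size; apply: eq_filter => k; rewrite !inE.
rewrite -{2}(cat_take_drop s (enum 'I_n)) count_cat.
have valE : map (@nat_of_ord n) (enum 'I_n) = iota 0 n by rewrite val_enum_ord.
have -> : count [pred k | (k \in F) && (k < s)%N] (drop s (enum 'I_n)) = 0%N.
  apply/eqP; rewrite -leqn0 leqNgt -has_count; apply/hasP => -[k].
  move=> /(map_f (@nat_of_ord n)); rewrite map_drop valE drop_iota mem_iota add0n => /andP[sk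
    _] /andP[_].
  by rewrite ltnNge sk.
rewrite addn0; apply: eq_in_count => k /(map_f (@nat_of_ord n)).
rewrite map_take valE take_iota mem_iota add0n => /andP[_ ks] /=.
by rewrite (leq_trans ks (geq_minl _ _)) andbT.
Qed.

Lemma count_word F : count id (word F) = #|F|.
Proof.
rewrite -[X in count _ X](@take_oversize _ n) ?size_tuple // count_take_word.
by congr #|pred_of_set _|; apply/setP => k; rewrite !inE ltn_ord andbT.
Qed.

End Words.

Lemma mu_tuples (R : realType) (p : R) n P :
  mu p n P = \sum_(x : n.-tuple bool | P x) p ^+ count id x * (1 - p) ^+ (n - count id x).
Proof.
elim: n P => [|n IH] P.
  rewrite big_mkcond (bigD1 [tuple]) //= big1 => [|x]; last by move=> /eqP[]; exact: tuple0.
  by rewrite addr0; case: (P [::]); rewrite //= mulr1.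
pose h (u : bool * n.-tuple bool) := [tuple of u.1 :: u.2].
have hbij : bijective h.
  exists (fun x => (thead x, [tuple of behead x])) => [[b x]|x].
    by rewrite /h /= theadE; congr (_, _); apply: val_inj.
  by rewrite /h /= [RHS]tuple_eta.
rewrite (reindex h) /=; last exact: onW_bij.
rewrite big_mkcond -(pair_bigA _ (fun b x => if P (h (b, x)) then
   p ^+ count id (h (b, x)) * (1 - p) ^+ (n.+1 - count id (h (b, x))) else 0)) /=.
rewrite big_bool /= !IH !big_distrr /=; congr (_ + _).
  rewrite big_mkcond; apply: eq_bigr => x _ /=; case: (P _) => //.
  by rewrite add1n subSS exprS mulrA.
rewrite big_mkcond; apply: eq_bigr => x _ /=; case: (P _) => //.
have le : (count id x <= n)%N by rewrite -[leqRHS](size_tuple x) count_size.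
by rewrite add0n subSn // exprS mulrCA.
Qed.

Lemma mu_pweight (R : realType) (p : R) n (A : {set {set 'I_n}}) :
  mu p n (fun w => wset n w \in A) = pweight p A.
Proof.
rewrite mu_tuples /pweight (reindex (@word n)) /=; last first.
  apply: onW_bij; exists (fun x => wset n (val x)); [exact: wordK|].
  by move=> x; apply: val_inj; apply: wsetK; rewrite size_tuple.
by apply: eq_big => [F|F _]; rewrite ?wordK // count_word.
Qed.

(** * Shifting *)

Section Shifting.
Variable n : nat.
Implicit Types (i j k : 'I_n) (F S X Y : {set 'I_n}) (A B : {set {set 'I_n}}).

Definition swp i j F : {set 'I_n} := [set k | tperm i j k \in F].

Lemma swpK i j : involutive (swp i j).
Proof. by move=> F; apply/setP => k; rewrite !inE tpermK. Qed.

Lemma swpE i j F : swp i j F = tperm i j @: F.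
Proof.
apply/setP => k; rewrite inE; apply/idP/imsetP => [kF|[l lF ->]]; last by rewrite tpermK.
by exists (tperm i j k); rewrite ?tpermK.
Qed.

Lemma card_swp i j F : #|swp i j F| = #|F|.
Proof. by rewrite swpE card_imset //; apply: perm_inj. Qed.

Lemma swpI i j F X : swp i j (F :&: X) = swp i j F :&: swp i j X.
Proof. by apply/setP => k; rewrite !inE. Qed.

Lemma swp_neutral i j F : (i \in F) = (j \in F) -> swp i j F = F.
Proof. by move=> ij; apply/setP => k; rewrite inE; case: tpermP => [->|->|]. Qed.

Lemma swpC i j F : swp i j F = swp j i F.
Proof. by rewrite /swp tpermC. Qed.

Lemma swp_l i j F : (i \in swp i j F) = (j \in F).
Proof. by rewrite inE tpermL. Qed.

Lemma swp_r i j F : (j \in swp i j F) = (i \in F).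
Proof. by rewrite inE tpermR. Qed.

(** The usual shift from j to i, described on each pair [F], [swp i j F]: the member with [i] is
    kept if A has either, the member with [j] if A has both. Thus each pair keeps its number of
    members. *)
Definition shift i j A : {set {set 'I_n}} :=
  [set F : {set 'I_n} | if (i \in F) && (j \notin F) then (F \in A) || (swp i j F \in A)
           else if (i \notin F) && (j \in F) then (F \in A) && (swp i j F \in A)
           else F \in A].

(** The delicate case has [i] but not [j] in both X and Y, with only one of the two swapped back.
    Swapping back trades the common point [i] for [j], absent from the other set, so the
    intersection can only shrink and the bound carries over to X and Y. *)
Lemma shift_cross t i j A B : cross_intersecting t A B ->
  cross_intersecting t (shift i j A) (shift i j B).
Proof.
move=> AB X Y XA YB.
have swpXY : swp i j X \in A -> swp i j Y \in B -> (t <= #|X :&: Y|)%N.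
  by move=> h1 h2; rewrite -(card_swp i j) swpI AB.
have sub (U V : {set 'I_n}) : i \in U -> j \notin U -> i \in V -> j \notin V ->
    swp i j U :&: V \subset U :&: V.
  move=> iU jU iV jV; apply/subsetP => k; rewrite !inE; case: tpermP => [->|->|//].
    by rewrite (negbTE jU).
  by rewrite (negbTE jV) andbF.
have cases C Z : Z \in shift i j C -> (Z \in C /\ swp i j Z \in C) \/
    [/\ i \in Z, j \notin Z & Z \in C \/ swp i j Z \in C].
  rewrite inE; case iZ: (i \in Z); case jZ: (j \in Z) => /=.
  - by rewrite swp_neutral ?iZ ?jZ //; left.
  - by move/orP; right.
  - by move/andP; left.
  - by rewrite swp_neutral ?iZ ?jZ //; left.
case: (cases _ _ XA) => [[X1 X2]|[iX jX XA']]; case: (cases _ _ YB) => [[Y1 Y2]|[iY jY YB']].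
- exact: AB.
- by case: YB' => h; [apply: AB | apply: swpXY].
- by case: XA' => h; [apply: AB | apply: swpXY].
case: XA' YB' => hX [hY|hY]; [exact: AB| | |exact: swpXY].
  apply: leq_trans (AB _ _ hX hY) _.
  by rewrite setIC [X :&: Y]setIC; apply: subset_leq_card; apply: sub.
by apply: leq_trans (AB _ _ hX hY) (subset_leq_card _); apply: sub.
Qed.

(* [F] and its swap contribute together; the pair is indexed by its member
   containing [i] but not [j]. *)
Lemma big_swp (R : Type) (idx : R) (op : Monoid.com_law idx) i j (f : {set 'I_n} -> R) :
  \big[op/idx]_F f F =
  op (\big[op/idx]_(F : {set 'I_n} | (i \in F) == (j \in F)) f F)
     (\big[op/idx]_(F : {set 'I_n} | (i \in F) && (j \notin F)) op (f F) (f (swp i j F))).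
Proof.
rewrite (bigID (fun F : {set 'I_n} => (i \in F) == (j \in F))) /=; congr (op _ _).
rewrite big_split /= (bigID (fun F : {set 'I_n} => i \in F)) /=; congr (op _ _).
  by apply: eq_bigl => F; case: (i \in F); case: (j \in F).
rewrite (reindex_inj (inv_inj (swpK i j))) /=; apply: eq_bigl => F.
by rewrite swp_l swp_r; case: (i \in F); case: (j \in F).
Qed.

Lemma pweight_shift (R : realType) (p : R) i j A : pweight p (shift i j A) = pweight p A.
Proof.
rewrite /pweight big_mkcond [RHS]big_mkcond !(big_swp _ i j) /=; congr (_ + _).
  apply: eq_bigr => F ij; rewrite inE.
  by case: (i \in F) ij; case: (j \in F).
apply: eq_bigr => F /andP[iF jF].
rewrite !inE tpermL tpermR swpK iF (negbTE jF) /= card_swp.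
by case: (F \in A); case: (swp i j F \in A); rewrite /= ?addr0 ?add0r.
Qed.

(** Unrelated to the height of a walk: this is the potential that shifting lowers. *)
Definition height F := (\sum_(k in F) k)%N.
Definition total_height A := (\sum_(F in A) height F)%N.

Lemma height_swp i j F : (i < j)%N -> i \in F -> j \notin F -> (height F < height (swp i j F))%N.
Proof.
move=> ij iF jF; rewrite /height swpE big_imset /=; last by move=> x y _ _; apply: perm_inj.
rewrite (bigD1 i) //= [ltnRHS](bigD1 i) //= tpermL -addSn leq_add // leq_sum // => k /andP[kF ki].
by rewrite tpermD // eq_sym //; apply: contraNneq jF => <-.
Qed.

Definition shifted A := forall i j F, (i < j)%N ->
  F \in A -> i \notin F -> j \in F -> swp i j F \in A.

Lemma shift_total_height i j A : (i < j)%N ->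
  (total_height (shift i j A) <= total_height A)%N /\
  (forall F, F \in A -> i \notin F -> j \in F -> swp i j F \notin A ->
   (total_height (shift i j A) < total_height A)%N).
Proof.
move=> ij; rewrite /total_height big_mkcond [X in (_ <= X)%N]big_mkcond [X in (_ <
  X)%N]big_mkcond.
rewrite !(big_swp _ i j) /=.
have -> : (\sum_(F : {set 'I_n} | (i \in F) == (j \in F)) (if F \in shift i j A then height F
  else 0) =
   \sum_(F : {set 'I_n} | (i \in F) == (j \in F)) (if F \in A then height F else 0))%N.
  by apply: eq_bigr => F; rewrite inE; case: (i \in F); case: (j \in F).
have pair F : (i \in F) && (j \notin F) ->
  ((if F \in shift i j A then height F else 0) +
    (if swp i j F \in shift i j A then height (swp i j F) else 0) +
    ((F \notin A) && (swp i j F \in A)) <=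
   (if F \in A then height F else 0) + (if swp i j F \in A then height (swp i j F) else 0))%N.
  move=> /andP[iF jF]; have := height_swp ij iF jF.
  rewrite !inE tpermL tpermR swpK iF (negbTE jF) /=.
  case: (F \in A); case: (swp i j F \in A) => /=; lia.
split.
  rewrite leq_add2l leq_sum // => F /pair; apply: leq_trans; exact: leq_addr.
move=> F FA iF jF nF; rewrite ltn_add2l.
have iG : (i \in swp i j F) && (j \notin swp i j F) by rewrite swp_l swp_r jF iF.
rewrite (bigD1 (swp i j F)) // [ltnRHS](bigD1 (swp i j F)) //=.
rewrite -addSn leq_add //.
  by have := pair _ iG; rewrite swpK FA nF /= addn1.
by apply: leq_sum => G /andP[/pair + _]; apply: leq_trans; exact: leq_addr.
Qed.

Lemma card_initseg s : (s <= n)%N -> #|initseg n s| = s.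
Proof.
move=> sn; have := count_take_word [set: 'I_n] s; rewrite setTI => <-.
rewrite (_ : count id _ = size (take s (word [set: 'I_n])));
  first by rewrite size_takel ?size_tuple.
apply/eqP; rewrite -all_count; apply/allP => b /mem_take /mapP[k _ ->] /=.
by rewrite inE.
Qed.

(** Take the least [s] with t common points below it. If X and Y cover [s], inclusion-exclusion
    gives s + t. Otherwise the last common point s - 1 is moved in X to an uncovered [x], which
    lowers X, and the time found by induction also serves for the original X. *)
Lemma shifted_cross t A B X Y : shifted A -> cross_intersecting t A B -> X \in A -> Y \in B ->
  exists2 s, (s <= n)%N & (s + t <= #|X :&: initseg n s| + #|Y :&: initseg n s|)%N.
Proof.
move=> shA AB XA YB; have [m] := ubnP (height X); elim: m X XA => // m IH X XA hX.
have initT : initseg n n = setT by apply/setP => k; rewrite !inE ltn_ord.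
have ex : exists s, (t <= #|X :&: Y :&: initseg n s|)%N by exists n; rewrite initT setIT AB.
case: (ex_minnP ex) => s hs min.
have sn : (s <= n)%N by apply: min; rewrite initT setIT AB.
have cU s' : (#|X :&: initseg n s'| + #|Y :&: initseg n s'| =
    #|(X :|: Y) :&: initseg n s'| + #|X :&: Y :&: initseg n s'|)%N.
  by rewrite setIUl setIIl cardsUI.
case cover: (initseg n s \subset X :|: Y).
  exists s => //; rewrite cU leq_add // -{1}(card_initseg sn) subset_leq_card //.
  by rewrite subsetI cover subxx.
have [x xs xXY] : exists2 x : 'I_n, (x < s)%N & x \notin X :|: Y.
  have /subsetPn[x] := negbT cover; by rewrite inE => xs xXY; exists x.
have s0 : (s.-1 < n)%N by move: sn xs; clear; lia.
pose k := Ordinal s0.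
have few s' : (s' < s)%N -> (#|X :&: Y :&: initseg n s'| < t)%N.
  by move=> s's; rewrite ltnNge; apply/negP => /min; rewrite leqNgt s's.
have kXY : k \in X :&: Y.
  apply/negPn/negP => kn; have ps : (s.-1 < s)%N by move: xs; clear; lia.
  have := few s.-1 ps; rewrite ltnNge (leq_trans hs) // subset_leq_card //; apply/subsetP => y;
    rewrite !inE => /andP[yXY ys].
  rewrite yXY /=; have : (y : nat) != s.-1.
    by apply: contraNneq kn => yk; rewrite (_ : k = y) ?inE //; apply: val_inj.
  by move: ys; clear; lia.
have [kX kY] : k \in X /\ k \in Y by move: kXY; rewrite inE => /andP.
move: xXY; rewrite inE negb_or => /andP[xX xY].
have xk : (x < k)%N.
  have : x != k by apply: contraNneq xX => ->.
  by rewrite -val_eqE /=; move: xs; clear; lia.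
have X'A : swp x k X \in A by apply: shA.
have lower : (height (swp x k X) < height X)%N.
  by rewrite -{2}(swpK x k X); apply: height_swp; rewrite ?swp_l ?swp_r.
have [s' s'n h] := IH _ X'A (leq_trans lower hX).
exists s' => //; apply: (leq_trans h); rewrite leq_add2r.
have [s'x|xs'] := leqP s' x.
  apply: subset_leq_card; apply/subsetP => y; rewrite !inE => /andP[+ ys'].
  by rewrite ys' andbT tpermD // -val_eqE /=; move: ys' s'x xk; rewrite /k /=; clear; lia.
have [s's|ss'] := ltnP s' s; last first.
  have neutral : swp x k (initseg n s') = initseg n s'.
    by apply: swp_neutral; rewrite !inE xs' /=; move: ss' xs; clear; lia.
  by rewrite -{1}neutral -swpI card_swp.
(* For x < s' < s the swap adds at most one point, while the gap [x] leaves at most s' - 1 points in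
   the union and minimality of [s] at most t - 1 in the intersection: the total stays below s' +
   t. *)
exfalso; have xs'in : x \in initseg n s' by rewrite inE.
have s'n' : (s' <= n)%N by [].
have h1 : (#|swp x k X :&: initseg n s'| <= 1 + #|X :&: initseg n s'|)%N.
  apply: (@leq_trans #|x |: X :&: initseg n s'|); last by rewrite cardsU1 leq_add2r leq_b1.
  apply: subset_leq_card; apply/subsetP => y; rewrite !inE => /andP[+ ys'].
  by move: ys'; case: tpermP => [->|->|_ _] ys' yX; rewrite ?eqxx ?kX ?yX ?ys' ?orbT.
have h2 : (#|(X :|: Y) :&: initseg n s'| < s')%N.
  rewrite -{2}(card_initseg s'n') (cardsD1 x (initseg n s')) xs'in add1n ltnS.
  apply: subset_leq_card; apply/subsetP => y; rewrite !inE => /andP[yXY ys'].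
  rewrite ys' andbT; apply: contraTneq yXY => ->; by rewrite negb_or xX.
have := few s' s's; have := cU s'; move: h h1 h2; clear; lia.
Qed.

(** * Threshold families and undoing a shift *)

Definition thick S m : {set {set 'I_n}} := [set F : {set 'I_n} | (m <= #|F :&: S|)%N].

Lemma card_swpI i j F S : #|swp i j F :&: S| = #|F :&: swp i j S|.
Proof. by rewrite -(card_swp i j) swpI swpK. Qed.

Lemma card_sub_exists S m : (m <= #|S|)%N -> exists2 P : {set 'I_n}, P \subset S & #|P| = m.
Proof.
elim: m => [_|m IH lt]; first by exists set0; rewrite ?sub0set ?cards0.
have [P PS Pm] := IH (ltnW lt).
have : S :\: P != set0.
  by rewrite -card_gt0 cardsD (setIidPr PS) Pm subn_gt0.
case/set0Pn => x; rewrite inE => /andP[xP xS]; exists (x |: P).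
  by apply/subsetP => y; rewrite !inE => /predU1P[->|/(subsetP PS)].
by rewrite cardsU1 xP Pm.
Qed.

Lemma swp_card_in i j F S : i \in S -> j \notin S -> i \in F -> j \notin F ->
  #|F :&: S| = #|swp i j F :&: S|.+1.
Proof.
move=> iS jS iF jF; rewrite (cardsD1 i) inE iF iS add1n; congr (#|pred_of_set _|.+1).
apply/setP => k; rewrite !inE; case: tpermP => [->|->|/eqP ki _].
- by rewrite eqxx (negbTE jF).
- by rewrite (negbTE jS) !andbF.
- by rewrite ki.
Qed.

(* A pair [F, swp i j F] with [i \in F] is critical when only one of its members
   belongs to [A]; the Kneser-type graph on critical pairs given by meeting in at most [t]
   points forces the same choice everywhere. *)
Lemma unshift t r i j S A B : (r < t)%N -> #|S| = (t + 2 * r)%N ->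
  cross_intersecting t A B -> shift i j A = thick S (t + r) -> shift i j B = thick S (t + r) ->
  exists2 S' : {set 'I_n}, #|S'| = (t + 2 * r)%N & A = thick S' (t + r) /\ B = thick S' (t + r).
Proof.
move=> rt cS AB eA eB.
have sh C F : shift i j C = thick S (t + r) -> (F \in shift i j C) = (t + r <= #|F :&: S|)%N.
  by move=> ->; rewrite inE.
have pairE C F : shift i j C = thick S (t + r) -> i \in F -> j \notin F ->
   ((F \in C) || (swp i j F \in C) = (t + r <= #|F :&: S|)%N) /\
   ((F \in C) && (swp i j F \in C) = (t + r <= #|swp i j F :&: S|)%N).
  move=> eC iF jF; rewrite -(sh C F) // -(sh C (swp i j F)) // !inE.
  by rewrite tpermL tpermR swpK iF (negbTE jF) /= [X in _ /\ X = _]andbC.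
have restE C F : shift i j C = thick S (t + r) -> (i \in F) = (j \in F) ->
   (F \in C) = (t + r <= #|F :&: S|)%N.
  by move=> eC ij; rewrite -(sh C F) // inE ij; case: (j \in F).
have conclude C S' : shift i j C = thick S (t + r) ->
   (forall F, (i \in F) = (j \in F) -> #|F :&: S'| = #|F :&: S|) ->
   (forall F, i \in F -> j \notin F ->
     (F \in C) = (t + r <= #|F :&: S'|)%N /\
       (swp i j F \in C) = (t + r <= #|swp i j F :&: S'|)%N) ->
   C = thick S' (t + r).
  move=> eC rest prs; apply/setP => F; rewrite inE.
  case iF: (i \in F); case jF: (j \in F).
  - by rewrite rest ?iF ?jF // restE // iF jF.
  - by have [] := prs F iF (negbT jF).
  - have [] := prs (swp i j F); rewrite ?swp_l ?swp_r ?jF ?iF // swpK.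
    by move=> _ ->.
  - by rewrite rest ?iF ?jF // restE // iF jF.
have [ijS|ijS] := eqVneq (i \in S) (j \in S).
  have same F : #|swp i j F :&: S| = #|F :&: S| by rewrite card_swpI swp_neutral.
  exists S => //; split; apply: conclude => // F iF jF;
    [have [] := pairE A F eA iF jF | have [] := pairE B F eB iF jF];
    rewrite same; case: (_ \in _); case: (_ \in _) => <- //= <-.
have [P PS cP] : exists2 P : {set 'I_n}, P \subset S :\ j & #|P| = (t + r - (j \in S))%N.
  apply: card_sub_exists; have := cardsD1 j S; rewrite cS.
  by move: #|S :\ j| rt; clear; case: (j \in S) => c /=; lia.
case iS: (i \in S) ijS PS cP => ijS PS cP; last first.
  have jS : j \in S by move: ijS; case: (j \in S).
  have jP : j \notin P by apply/negP => /(subsetP PS); rewrite !inE eqxx.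
  have PS' : P \subset S by apply: subset_trans PS (subsetDl _ _).
  have iP : i \notin P by apply/negP => /(subsetP PS'); rewrite iS.
  have ij : i != j by apply: contraFneq iS => ->.
  (* [F] has t + r - 1 points in [S] and its swap t + r: the shifted family would contain the member
     with [j] without the one with [i], which no shift allows. *)
  pose F := i |: P.
  have iF : i \in F by rewrite !inE eqxx.
  have jF : j \notin F by rewrite !inE negb_or eq_sym ij.
  have [h1 h2] := pairE A F eA iF jF; exfalso.
  have c1 : #|F :&: S| = #|P|.
    rewrite setIUl (_ : [set i] :&: S = set0) ?set0U ?(setIidPl PS') //.
    by apply/setP => k; rewrite !inE; case: eqP => [->|] //; rewrite iS.
  have c2 : #|swp i j F :&: S| = #|P|.+1.
    have := @swp_card_in j i (swp i j F) S jS (negbT iS).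
    by rewrite swp_l swp_r iF jF swpC swpK c1 => ->.
  move: h1 h2; rewrite c1 c2 cP jS; case: (F \in A); case: (_ \in A) => /=; move: rt; clear; lia.
case jS: (j \in S) ijS PS cP => // _ _ _.
pose crit F := [&& i \in F, j \notin F & #|F :&: S| == (t + r)%N].
have swp1 F : i \in F -> j \notin F -> #|F :&: S| = #|swp i j F :&: S|.+1.
  by apply: swp_card_in; rewrite ?jS.
have one C F : shift i j C = thick S (t + r) -> crit F -> (swp i j F \in C) = (F \notin C).
  move=> eC /and3P[iF jF /eqP cF]; have [h1 h2] := pairE C F eC iF jF.
  have := swp1 F iF jF; rewrite cF => c1; move: h1 h2; rewrite cF leqnn.
  have -> : (t + r <= #|swp i j F :&: S|)%N = false by move: c1; clear; lia.
  by case: (F \in C); case: (_ \in C).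
(* Otherwise D contains the swap of [G], which trades the common point [i] for [j], absent from [F],
   and so meets [F] in fewer than [t] points. *)
have few C D F G : cross_intersecting t C D -> shift i j D = thick S (t + r) ->
    crit F -> crit G -> (#|F :&: G| <= t)%N -> F \in C -> G \in D.
  move=> CD eD cF cG FG FC; apply/negPn/negP => nG.
  have GD : swp i j G \in D by rewrite (one D G eD cG).
  case/and3P: cF => iF jF _; case/and3P: cG => iG jG _.
  have := CD _ _ FC GD; apply/negP; rewrite -ltnNge.
  apply: leq_trans FG; rewrite [ltnRHS](cardsD1 i) inE iF iG add1n ltnS.
  apply: subset_leq_card; apply/subsetP => k; rewrite !inE => /andP[kF].
  case: tpermP => [->|kj|/eqP -> _ ->]; first by rewrite (negbTE jG).
    by rewrite kj (negbTE jF) in kF.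
  by rewrite kF.
have crossC : cross_intersecting t B A by move=> X Y XB YA; rewrite setIC AB.
have common F1 F2 : crit F1 -> crit F2 ->
    exists G, [/\ crit G, (#|F1 :&: G| <= t)%N & (#|F2 :&: G| <= t)%N].
  move=> /and3P[i1 j1 /eqP c1] /and3P[i2 j2 /eqP c2].
  (* The common neighbour is S minus H: it has t + r points, and [F1] and [F2] each meet it in t.
     They share at least 2(t + r) - (t + 2r) = t points of [S], and r < t leaves enough of them once
     [i] is excluded. *)
  have [H HS cH] : exists2 H : {set 'I_n}, H \subset (S :&: F1 :&: F2) :\ i & #|H| = r.
    apply: card_sub_exists.
    have e1 := cardsD1 i (F1 :&: S :&: F2); rewrite !inE iS i1 i2 /= in e1.
    have e2 := cardsID F2 (F1 :&: S); rewrite c1 in e2.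
    have e3 := cardsID F2 S; rewrite [S :&: F2]setIC c2 cS in e3.
    have e4 : (#|F1 :&: S :\: F2| <= #|S :\: F2|)%N.
      by apply: subset_leq_card; apply: setSD; apply: subsetIr.
    rewrite [S :&: F1]setIC.
    move: #|_ :\ i| #|_ :&: F2| #|F1 :&: S :\: F2| #|S :\: F2| e1 e2 e3 e4.
    by move: rt; clear; lia.
  have Hin k : k \in H -> [/\ k != i, k \in S, k \in F1 & k \in F2].
    by move=> /(subsetP HS); rewrite !inE => /and3P[? /andP[? ?] ?].
  have sz F : #|F :&: S| = (t + r)%N -> (forall k, k \in H -> k \in F) ->
      (#|F :&: (S :\: H)| <= t)%N.
    move=> cF HF; have := cardsID H (F :&: S); rewrite cF.
    have -> : F :&: S :&: H = H.
      by apply/setIidPr/subsetP => k kH; rewrite inE HF //; have [] := Hin k kH.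
    by rewrite cH setIDA; clear; lia.
  exists (S :\: H); split; last first.
  - by apply: sz => // k /Hin[].
  - by apply: sz => // k /Hin[].
  apply/and3P; split.
  - by rewrite inE iS andbT; apply/negP => /Hin[]; rewrite eqxx.
  - by rewrite inE jS andbF.
  rewrite (setIidPl (subsetDl _ _)) cardsD (setIidPr _) ?cH ?cS; last first.
    by apply/subsetP => k /Hin[].
  by apply/eqP; clear; lia.
have AtoB F G : crit F -> crit G -> (#|F :&: G| <= t)%N -> (F \in A) = (G \in B).
  move=> cF cG FG; apply/idP/idP; first exact: few AB eB cF cG FG.
  by apply: few crossC eA cG cF _; rewrite setIC.
have sameA F1 F2 : crit F1 -> crit F2 -> (F1 \in A) = (F2 \in A).
  by move=> c1 c2; have [G [cG G1 G2]] := common _ _ c1 c2; rewrite !(@AtoB _ G).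
have sameB F1 F2 : crit F1 -> crit F2 -> (F1 \in B) = (F2 \in B).
  move=> c1 c2; have [G [cG G1 G2]] := common _ _ c1 c2.
  by rewrite -(@AtoB G F1) -?(@AtoB G F2) // setIC.
have sameAB F : crit F -> (F \in A) = (F \in B).
  by move=> cF; have [G [cG FG _]] := common _ _ cF cF; rewrite (@AtoB _ G) //; apply: sameB.
have allin C : shift i j C = thick S (t + r) -> (forall F, crit F -> F \in C) ->
  C = thick S (t + r).
  move=> eC all; apply: conclude => // F iF jF; have [h1 h2] := pairE C F eC iF jF.
  have [cF|ncF] := eqVneq #|F :&: S| (t + r)%N.
    have cr : crit F by rewrite /crit iF jF cF eqxx.
    rewrite (one C F eC cr) (all F cr) cF leqnn; split=> //; apply/esym/negbTE.
    by rewrite -ltnNge -cF (swp1 F iF jF).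
  have e : (t + r <= #|F :&: S|)%N = (t + r <= #|swp i j F :&: S|)%N.
    by move: ncF; rewrite (swp1 F iF jF); clear; lia.
  by move: h1 h2; rewrite e; case: (F \in C); case: (_ \in C) => <- //= <-.
(* If C contains no critical set, it contains all their swaps, so [j] takes the place of [i] in the
   threshold set. *)
have allout C : shift i j C = thick S (t + r) -> (forall F, crit F -> F \notin C) ->
    C = thick (swp i j S) (t + r).
  move=> eC none; apply: conclude => // [F ij|F iF jF].
    by rewrite -card_swpI swp_neutral.
  rewrite -!card_swpI swpK; have [h1 h2] := pairE C F eC iF jF.
  have [cF|ncF] := eqVneq #|F :&: S| (t + r)%N.
    have cr : crit F by rewrite /crit iF jF cF eqxx.
    rewrite (one C F eC cr) (negbTE (none F cr)) cF leqnn; split=> //; apply/esym/negbTE.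
    by rewrite -ltnNge -cF (swp1 F iF jF).
  have e : (t + r <= #|F :&: S|)%N = (t + r <= #|swp i j F :&: S|)%N.
    by move: ncF; rewrite (swp1 F iF jF); clear; lia.
  by move: h1 h2; rewrite e; case: (F \in C); case: (_ \in C) => <- //= <-.
have [[F0 [cr0 F0A]]|allA] := pselect (exists F, crit F /\ F \notin A).
  exists (swp i j S); first by rewrite card_swp.
  have noneA F : crit F -> F \notin A by move=> cF; rewrite (sameA F F0).
  by split; apply: allout => // F cF; rewrite -?sameAB // noneA.
have inA F : crit F -> F \in A.
  by move=> cF; apply/negPn/negP => nF; apply: allA; exists F.
by exists S => //; split; apply: allin => // F cF; rewrite -?sameAB // inA.
Qed.
End Shifting.

(** * Isomorphism with the Frankl families *)

(** The permutation matches, position by position, an enumeration starting with [S'] and one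
    starting with [S]. *)
Lemma perm_imset_exists (T : finType) (S S' : {set T}) : #|S| = #|S'| ->
  exists s : {perm T}, S = s @: S'.
Proof.
move=> cSS; pose e (U : {set T}) := enum U ++ enum (~: U).
have me U x : x \in e U by rewrite mem_cat !mem_enum inE orbN.
have ue U : uniq (e U).
  rewrite cat_uniq !enum_uniq andbT /=; apply/hasPn => x; rewrite !mem_enum inE.
  by apply.
have se U : size (e U) = #|T| by rewrite size_cat -!cardE cardsC.
pose f x := nth x (e S) (index x (e S')).
have f_inj : injective f.
  move=> x y; rewrite /f (set_nth_default x) ?se -?(se S') ?index_mem // => /eqP.
  by rewrite nth_uniq ?se -?(se S') ?index_mem // => /eqP/(congr1 (nth x (e S')));
    rewrite !nth_index.
exists (perm f_inj); apply/esym/eqP.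
rewrite eqEcard card_imset ?cSS ?leqnn ?andbT; last exact: perm_inj.
apply/subsetP => _ /imsetP[x xS ->]; rewrite permE /f /e index_cat mem_enum xS nth_cat.
have lt : (index x (enum S') < size (enum S))%N by rewrite -cardE cSS cardE index_mem mem_enum.
by rewrite lt -mem_enum mem_nth.
Qed.

Lemma frankl_thick n t r : frankl n t r = thick (initseg n (t + 2 * r)) (t + r).
Proof. by []. Qed.

Lemma imset_thick n (s : {perm 'I_n}) S m :
  [set s @: G | G : {set 'I_n} in thick S m] = thick (s @: S) m.
Proof.
apply/setP => F; rewrite inE; apply/imsetP/idP => [[G]|le].
  rewrite inE => le ->; rewrite -imsetI => [|x y _ _]; last exact: perm_inj.
  by rewrite card_imset //; apply: perm_inj.
have FE : F = s @: (s^-1%g @: F).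
  by rewrite -imset_comp (eq_imset (g := id)) ?imset_id // => x /=; rewrite permKV.
exists (s^-1%g @: F) => //; rewrite inE -(card_imset _ (@perm_inj _ s)).
by rewrite imsetI -?FE // => x y _ _; apply: perm_inj.
Qed.

Lemma isomorphicP n t r (B : {set {set 'I_n}}) : (t + 2 * r <= n)%N ->
  isomorphic B (frankl n t r) <->
  exists2 S : {set 'I_n}, #|S| = (t + 2 * r)%N & B = thick S (t + r).
Proof.
move=> le; have cI := card_initseg le; split=> [[s ->]|[S cS ->]].
  exists (s @: initseg n (t + 2 * r)); first by rewrite card_imset //; apply: perm_inj.
  by rewrite frankl_thick imset_thick.
have [s ->] : exists s : {perm 'I_n}, S = s @: initseg n (t + 2 * r).
  by apply: perm_imset_exists; rewrite cS cI.
by exists s; rewrite frankl_thick imset_thick.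
Qed.

Lemma pweight_perm (R : realType) (p : R) n (s : {perm 'I_n}) (A : {set {set 'I_n}}) :
  pweight p [set s @: G | G : {set 'I_n} in A] = pweight p A.
Proof.
rewrite /pweight big_imset /=; last by move=> F G _ _; apply: imset_inj; apply: perm_inj.
by apply: eq_bigr => F _; rewrite card_imset //; apply: perm_inj.
Qed.

Lemma pweight_frankl (R : realType) (p : R) n t r : (t + 2 * r <= n)%N ->
  pweight p (frankl n t r) = tail p (t + 2 * r) r.
Proof.
move=> le; rewrite -mu_pweight -(mu_tall p r le); apply: eq_mu => w sw.
by rewrite !inE -{2}(wsetK sw) /tall count_take_word; clear; lia.
Qed.

(** * The theorem for families of sets *)

Section CrossIntersecting.
Variables (R : realType) (t : nat) (p : R).
Hypothesis t200 : (200 <= t)%N.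
Hypothesis p_ge : 1 <= p * (t%:R + 1).
Hypothesis p_le : p * (t%:R + 3) <= 2.
Let q : R := 1 - p.
Let f1 : R := (t%:R + 2) * p ^+ (t + 1) * q + p ^+ (t + 2).

Lemma cross_theorem n (A B : {set {set 'I_n}}) : cross_intersecting t A B ->
  pweight p A * pweight p B <= f1 ^+ 2 /\
  (pweight p A * pweight p B = f1 ^+ 2 ->
    exists r (S : {set 'I_n}), [/\ (t + 2 * r <= n)%N, critical t p r, #|S| = (t + 2 * r)%N,
      A = thick S (t + r) & B = thick S (t + r)]).
Proof.
have [m] := ubnP (total_height A + total_height B); elim: m A B => // m IH A B hm cross.
have step (i j : 'I_n) : (i < j)%N ->
   (total_height (shift i j A) + total_height (shift i j B) < total_height A + total_height
     B)%N ->
   pweight p A * pweight p B <= f1 ^+ 2 /\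
  (pweight p A * pweight p B = f1 ^+ 2 ->
    exists r (S : {set 'I_n}), [/\ (t + 2 * r <= n)%N, critical t p r, #|S| = (t + 2 * r)%N,
      A = thick S (t + r) & B = thick S (t + r)]).
  move=> ij lt; have [|le eq] := IH _ _ _ (shift_cross (i := i) (j := j) cross).
    by apply: leq_trans lt _.
  rewrite !pweight_shift in le eq; split=> // /eq[r [S [tr cr cS eA eB]]].
  have rt : (r < t)%N by case: cr => [[-> _]|->|[-> _]]; move: t200; clear; lia.
  by have [S' cS' [eA' eB']] := unshift rt cS cross eA eB; exists r, S'.
(* Shifting stops once A is shifted, which is all that [shifted_cross] requires; B is shifted along
   with A to keep the pair cross-intersecting. *)
have [shA|nshA] := pselect (shifted A); last first.
  have [i [j [F [ij FA iF jF nF]]]] : exists (i j : 'I_n) (F : {set 'I_n}),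
      [/\ (i < j)%N, F \in A, i \notin F, j \in F & swp i j F \notin A].
    apply: contrapT => no; apply: nshA => i j F ij FA iF jF; apply/negPn/negP => nF.
    by apply: no; exists i, j, F.
  have [_ lt] := shift_total_height A ij; have [le _] := shift_total_height B ij.
  apply: (step i j ij).
  by rewrite -addSn leq_add // (lt F).
have wcross : walk_cross t n (fun w => wset n w \in A) (fun w => wset n w \in B).
  move=> X Y sX sY XA YB; have [k kn h] := shifted_cross shA cross XA YB.
  by exists k => //; rewrite -(wsetK sX) -(wsetK sY) !count_take_word.
have := walk_theorem t200 p_ge p_le wcross; rewrite !mu_pweight => -[le eq].
split=> // /eq[r [tr cr eA eB]]; exists r, (initseg n (t + 2 * r)).
have ext (C : {set {set 'I_n}}) : extremal t n r (fun w => wset n w \in C) ->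
    C = thick (initseg n (t + 2 * r)) (t + r).
  move=> eC; apply/setP => F; rewrite inE -{1}(wordK F) eC ?size_tuple //.
  by rewrite /tall count_take_word; clear; lia.
by split=> //; [exact: card_initseg | exact: ext | exact: ext].
Qed.

End CrossIntersecting.

Theorem theorem1p2 (R : realType) (n t : nat) (p : R)
    (hnt : (t <= n)%N) (ht : (200 <= t)%N)
    (hp1 : 1 / (t%:R + 1) <= p) (hp2 : p <= 2 / (t%:R + 3))
    (A B : {set {set 'I_n}}) (hAB : cross_intersecting t A B) :
  let q := 1 - p in
  let bound := ((t%:R + 2) * p ^+ (t + 1) * q + p ^+ (t + 2)) ^+ 2 in
  [/\ pweight p A * pweight p B <= bound,
      (t + 2 <= n)%N -> pweight p (frankl n t 1) ^+ 2 = bound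
    & pweight p A * pweight p B = bound <->
      [\/ [/\ A = B, isomorphic B (frankl n t 0) & p = 1 / (t%:R + 1)],
          [/\ (t + 2 <= n)%N, A = B, isomorphic B (frankl n t 1)
            & 1 / (t%:R + 1) <= p <= 2 / (t%:R + 3)]
        | [/\ (t + 4 <= n)%N, A = B, isomorphic B (frankl n t 2)
            & p = 2 / (t%:R + 3)]]].
Proof.
move=> q bound.
have t1 : 0 < t%:R + 1 :> R by rewrite addr_gt0 // ltr0n (leq_trans _ ht).
have t3 : 0 < t%:R + 3 :> R by rewrite addr_gt0 // ltr0n (leq_trans _ ht).
have p_ge : 1 <= p * (t%:R + 1) by rewrite -ler_pdivrMr.
have p_le : p * (t%:R + 3) <= 2 by rewrite -ler_pdivlMr.
have divE (c d : R) : 0 < d -> p = c / d <-> p * d = c.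
  by move=> d0; split=> [->|<-]; rewrite ?divfK ?mulfK ?gt_eqF.
have p1E := divE 1 _ t1; have p3E := divE 2 _ t3.
have [le eq] := cross_theorem ht p_ge p_le hAB.
have crit2 r : critical t p r -> (r <= 2)%N by case=> [[-> _]|->|[-> _]].
have pw r : (t + 2 * r <= n)%N -> critical t p r -> pweight p (frankl n t r) ^+ 2 = bound.
  move=> tr cr; rewrite pweight_frankl //.
  have [_ te] := tail_diag ht p_ge p_le (crit2 r cr).
  by move: cr => /te ->.
have isoE r : (t + 2 * r <= n)%N -> critical t p r -> A = B -> isomorphic B (frankl n t r) ->
    pweight p A * pweight p B = bound.
  by move=> tr cr -> [s ->]; rewrite pweight_perm -expr2 pw.
split=> //; first by move=> tn; apply: pw; [exact: tn | exact: Or32].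
split=> [/eq[r [S [tr cr cS eA eB]]]|].
  have AB : A = B by rewrite eA eB.
  have iso : isomorphic B (frankl n t r) by apply/isomorphicP => //; exists S.
  case: cr => [[r0 /p1E h]|r1|[r2 /p3E h]].
  - by apply: Or31; split=> //; rewrite -r0.
  - by apply: Or32; rewrite r1 in tr iso; split=> //; rewrite hp1.
  - by apply: Or33; rewrite r2 in tr iso; split.
case=> [[AB iso h]|[tn AB iso _]|[tn AB iso h]].
- by apply: (isoE 0%N) => //; [rewrite muln0 addn0 | apply: Or31; split=> //; apply/p1E].
- by apply: (isoE 1%N) => //; apply: Or32.
- by apply: (isoE 2%N) => //; apply: Or33; split=> //; apply/p3E.
Qed.
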